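(* If the Exponential Time Hypothesis is true, then \textsc{Unweighted Stars NWS} cannot be solved in $2^{o(n^2+c)} \cdot \mathrm{poly}(n+c)$ time, even when restricted to instances in which the input graph $G$ is a clique and each community has size at most $4$.
   Context: An instance of \textsc{Stars NWS} consists of a graph $G$, a collection $\mathcal{C}$ of $c$ subsets of $V(G)$ (called communities), an edge-weight function $\omega: E(G)\to \mathbb{R}_+$, an integer $\ell$, and a positive real $b$. The question is whether there is a spanning subgraph $G'=(V(G),E')$ with $E'\subseteq E(G)$, $|E'|\le \ell$ and total edge weight $\omega(E')\le b$ such that for every community $C\in\mathcal{C}$ the induced subgraph $G'[C]$ contains a spanning star, i.e. some vertex $v\in C$ is adjacent in $G'$ to every vertex of $C\setminus\{v\}$. \textsc{Unweighted Stars NWS} is the special case in which every edge has weight $1$. Here $n=|V(G)|$ and $c=|\mathcal{C}|$. *)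

(* Defs.v *)
From HB Require Import structures.
From mathcomp Require Import all_boot all_order all_algebra.
From mathcomp Require Import all_classical all_reals all_analysis.
Set Implicit Arguments.
Unset Strict Implicit.
Unset Printing Implicit Defensive.
Import Order.TTheory GRing.Theory Num.Theory.
Import numFieldNormedType.Exports.
Local Open Scope ring_scope.

(** * Algorithms and running time

    Algorithms are programs of the language WHILE of N. D. Jones,
    "Computability and Complexity from a Programming Perspective" (MIT Press,
    1997), over binary trees with the single atom [Leaf] (nil), with the
    conditional, definable from loops there, as a primitive.  Each operation has
    unit cost.  There is no equality test on trees, so a run of t steps is
    simulated on a graph with sharing, and the running time is polynomially
    related to that of a Turing machine.  Exponential lower bounds of the form
    2^(delta n) poly or 2^(o(n)) poly do not depend on the choice among
    polynomially related models. *)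

Inductive tree : Type := Leaf | Node of tree & tree.

Definition hd (t : tree) : tree := if t is Node a _ then a else Leaf.
Definition tl (t : tree) : tree := if t is Node _ b then b else Leaf.

Inductive expr : Type :=
  | EVar of nat
  | ENil
  | ECons of expr & expr
  | EHd of expr
  | ETl of expr.

Inductive cmd : Type :=
  | Assign of nat & expr
  | Seq of cmd & cmd
  | If of expr & cmd & cmd
  | While of expr & cmd.

Definition store : Type := nat -> tree.

Definition upd (s : store) (x : nat) (v : tree) : store :=
  fun y => if y == x then v else s y.

Fixpoint eval (e : expr) (s : store) : tree :=
  match e with
  | EVar x => s x
  | ENil => Leaf
  | ECons e1 e2 => Node (eval e1 s) (eval e2 s)
  | EHd e1 => hd (eval e1 s)
  | ETl e1 => tl (eval e1 s)
  end.

Fixpoint ecost (e : expr) : nat :=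
  match e with
  | EVar _ | ENil => 1
  | ECons e1 e2 => (ecost e1 + ecost e2).+1
  | EHd e1 | ETl e1 => (ecost e1).+1
  end.

(* [exec c s t s']: started in s, c halts in s' after exactly t steps;
   [Leaf] is the only false value in tests. *)
Inductive exec : cmd -> store -> nat -> store -> Prop :=
  | ExecAssign x e s :
      exec (Assign x e) s (ecost e).+1 (upd s x (eval e s))
  | ExecSeq c1 c2 s s1 s2 t1 t2 :
      exec c1 s t1 s1 -> exec c2 s1 t2 s2 ->
      exec (Seq c1 c2) s (t1 + t2).+1 s2
  | ExecIfTrue e c1 c2 s s1 t :
      eval e s <> Leaf -> exec c1 s t s1 ->
      exec (If e c1 c2) s (ecost e + t).+1 s1
  | ExecIfFalse e c1 c2 s s1 t :
      eval e s = Leaf -> exec c2 s t s1 ->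
      exec (If e c1 c2) s (ecost e + t).+1 s1
  | ExecWhileTrue e c s s1 s2 t1 t2 :
      eval e s <> Leaf -> exec c s t1 s1 -> exec (While e c) s1 t2 s2 ->
      exec (While e c) s (ecost e + t1 + t2).+1 s2
  | ExecWhileFalse e c s :
      eval e s = Leaf -> exec (While e c) s (ecost e).+1 s.

(* Input and output are in variable 0; all other variables start as [Leaf]. *)
Definition init_store (input : tree) : store := upd (fun=> Leaf) 0%N input.

Definition answers_within (R : realType) (p : cmd) (input : tree)
    (answer : Prop) (bound : R) : Prop :=
  exists (t : nat) (s : store),
    [/\ exec p (init_store input) t s, t%:R <= bound & s 0%N <> Leaf <-> answer].

Definition enc_bool (b : bool) : tree := if b then Node Leaf Leaf else Leaf.
Definition enc_nat (n : nat) : tree := iter n (Node Leaf) Leaf.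
Definition enc_int (z : int) : tree :=
  match z with
  | Posz n => Node (enc_bool false) (enc_nat n)
  | Negz n => Node (enc_bool true) (enc_nat n.+1)
  end.
Definition enc_seq (T : Type) (enc : T -> tree) (s : seq T) : tree :=
  foldr (fun x => Node (enc x)) Leaf s.

(** * The Exponential Time Hypothesis *)

Definition literal (n : nat) : Type := ('I_n * bool)%type.
Definition cnf (n : nat) : Type := seq (seq (literal n)).

Definition is_3cnf (n : nat) (phi : cnf n) : Prop :=
  forall cl, cl \in phi -> (size cl <= 3)%N.

Definition satisfiable (n : nat) (phi : cnf n) : Prop :=
  exists a : 'I_n -> bool,
    forall cl, cl \in phi -> exists2 l, l \in cl & a l.1 = l.2.

Definition enc_literal (n : nat) (l : literal n) : tree :=
  Node (enc_nat l.1) (enc_bool l.2).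

Definition enc_cnf (n : nat) (phi : cnf n) : tree :=
  Node (enc_nat n) (enc_seq (enc_seq (@enc_literal n)) phi).

(* The exponent depends on the number of variables only; the number of clauses
   enters through the polynomial factor. *)
Definition ETH (R : realType) : Prop :=
  exists2 delta : R, 0 < delta &
    ~ exists (p : cmd) (q : {poly nat}),
        forall (n : nat) (phi : cnf n), is_3cnf phi ->
          answers_within p (enc_cnf phi) (satisfiable phi)
            (2 `^ (delta * n%:R) * (q.[(n + size phi)%N])%:R).

(** * Stars NWS *)

(* The collection of communities is a duplicate-free list, so that an algorithm
   may receive its members in any order. *)
Record instance (R : realType) : Type := Instance {
  nverts : nat;
  edges : {set {set 'I_nverts}};
  edges_card2 : forall e, e \in edges -> #|e| = 2%N;
  communities : seq {set 'I_nverts};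
  communities_uniq : uniq communities;
  weight : {set 'I_nverts} -> R;
  weight_ge0 : forall e, e \in edges -> 0 <= weight e;
  edge_budget : int;
  weight_budget : R;
  weight_budget_gt0 : 0 < weight_budget
}.

Definition ncomms (R : realType) (I : instance R) : nat :=
  size (communities I).

Definition has_spanning_star (n : nat) (E : {set {set 'I_n}}) (C : {set 'I_n})
    : Prop :=
  exists2 v, v \in C & forall u, u \in C -> u != v -> [set v; u] \in E.

Definition stars_nws (R : realType) (I : instance R) : Prop :=
  exists E' : {set {set 'I_(nverts I)}},
    [/\ E' \subset edges I,
        Posz #|E'| <= edge_budget I,
        \sum_(e in E') weight e <= weight_budget I
      & forall C, C \in communities I -> has_spanning_star E' C].

Definition unweighted (R : realType) (I : instance R) : Prop :=
  forall e, e \in edges I -> weight e = 1.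

Definition is_clique (R : realType) (I : instance R) : Prop :=
  forall u v : 'I_(nverts I), u != v -> [set u; v] \in edges I.

(* The number of vertices, the adjacency matrix, the indicator vectors of the
   communities, and the two budgets.  Of the real weight budget only the integer
   part is given: it determines the answer when all weights are 1.  Both budgets
   are unary, so their parts beyond n^2 need not be read, and arbitrarily large
   budgets do not by themselves rule out a running time bounded in n and c. *)
Definition enc_unweighted (R : realType) (I : instance R) : tree :=
  let V := enum 'I_(nverts I) in
  let row (P : pred 'I_(nverts I)) := enc_seq (fun v => enc_bool (P v)) V in
  Node (enc_nat (nverts I))
  (Node (enc_seq (fun u => row (fun v => [set u; v] \in edges I)) V)
  (Node (enc_seq (fun C : {set 'I_(nverts I)} => row (fun v => v \in C))
           (communities I))
  (Node (enc_int (edge_budget I))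
        (enc_nat (Num.truncn (weight_budget I)))))).

(* Main.v *)
Require Import Defs.
From HB Require Import structures.
From mathcomp Require Import all_boot all_order all_algebra.
From mathcomp Require Import all_classical all_reals all_analysis.
From mathcomp Require Import zify ring lra.
Import Defs.
Set Implicit Arguments.
Unset Strict Implicit.
Unset Printing Implicit Defensive.
Import Order.TTheory GRing.Theory Num.Theory.
Import numFieldNormedType.Exports.
Local Open Scope nat_scope.

(** Since the hypothesis bounds the exponent by the number of variables only,
    the clauses must first be sparsified.  Literals are treated as elements to be
    hit: a state consists of unit clauses [U] and 2-clauses [B] added to the fixed
    3-clauses [T].  When a literal lies in many live 2-clauses, a pair in many live
    3-clauses, or a literal in many live 3-clauses, one branches on adding the
    common part or all the remainders.  The potential [8 t1 #live - #pairs] drops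
    by 1 in the first branch and by about [t1^2] in the second, so the search tree
    has 2^(small * n) leaves, each with a formula in which every literal occurs a
    bounded number of times.

    Such a formula is encoded in a clique on O(sqrt n) vertices, split into rows
    and columns that are joined internally by communities of size 2.  A community
    [u :: S] with [S] inside one side then says that some edge from [u] to [S] is
    chosen.  A cell, i.e. a row and a pair of columns, carries a truth value: one
    of its two edges is forced and the budget forbids both.  Variable [v] has home
    coordinates [(h, b)] in a square grid and a cell in row [h] for each of the
    three clause positions; a clause gets a row of its own or one shared with
    clauses having other column coordinates in every position, which a greedy
    choice among O(sqrt n) rows achieves.  The value at home is the negation of
    the variable. *)

(** * The class of polynomial-time functions *)

(** The size measure contains the square of the number of vertices, so a formula of linear size has
    to live on the edges between O(sqrt N) vertices. A disjunction speaks only of edges at one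
    vertex; hence a truth value can move only along a row or along a column. An occurrence of a
    variable is reached from its home by one move along the home row, from block 0 of the columns to
    the block of the clause position, and one move down that column. With exactly one edge per cell,
    the two disjunctions at a column pair make its two cells disagree, which is why the home stores
    the negation. Separate blocks for the three positions keep the literals of one clause, possibly
    repeated, from competing for a cell.

    In the sparsification, pairs are branched on before the links of literals because adding a link
    could otherwise create literals of large degree, and the potential is controlled only while all
    degrees are at most [2 * t1]. The sparsification runs inside the constructed program, which
    calls the assumed solver at the leaves. *)

Fixpoint evars (e : expr) : nat :=
  match e with
  | EVar x => x.+1
  | ENil => 0
  | ECons e1 e2 => maxn (evars e1) (evars e2)
  | EHd e1 | ETl e1 => evars e1
  end.

Fixpoint cvars (c : cmd) : nat :=
  match c with
  | Assign x e => maxn x.+1 (evars e)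
  | Seq c1 c2 => maxn (cvars c1) (cvars c2)
  | If e c1 c2 => maxn (evars e) (maxn (cvars c1) (cvars c2))
  | While e c1 => maxn (evars e) (cvars c1)
  end.

(** [cvars c] exceeds every variable index in [c], so variables from there on are safe storage
    across a run of [c]; composite programs keep intermediate values there. *)
Lemma exec_frame c s t s' : exec c s t s' ->
  forall y, cvars c <= y -> s' y = s y.
Proof.
elim=> {c s t s'} //=.
- move=> x e s y; rewrite geq_max => /andP[xy _].
  by rewrite /upd; case: eqP => // yx; rewrite yx ltnn in xy.
- move=> c1 c2 s s1 s2 t1 t2 _ IH1 _ IH2 y; rewrite geq_max => /andP[h1 h2].
  by rewrite IH2 // IH1.
- by move=> e c1 c2 s s1 t _ _ IH y; rewrite !geq_max => /and3P[_ h _]; apply: IH.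
- by move=> e c1 c2 s s1 t _ _ IH y; rewrite !geq_max => /and3P[_ _ h]; apply: IH.
- move=> e c s s1 s2 t1 t2 _ _ IH1 _ IH2 y h; rewrite IH2 // IH1 //.
  by move: h; rewrite geq_max => /andP[].
Qed.

Lemma eval_agree e (s s2 : store) k : evars e <= k ->
  (forall y, y < k -> s2 y = s y) -> eval e s2 = eval e s.
Proof.
move=> + H; elim: e => [x||e1 IH1 e2 IH2|e IH|e IH] //=.
- exact: H.
- by rewrite geq_max => /andP[h1 h2]; rewrite IH1 // IH2.
- by move=> h; rewrite IH.
- by move=> h; rewrite IH.
Qed.

(** Only variables below [k] can influence the run. This lets a solver specified on the initial
    store run inside a larger program that keeps a stack and a flag in higher variables. *)
Lemma exec_agree c s t s' : exec c s t s' ->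
  forall k s2, cvars c <= k -> (forall y, y < k -> s2 y = s y) ->
  exists2 s2', exec c s2 t s2' & forall y, y < k -> s2' y = s' y.
Proof.
elim=> {c s t s'} /=.
- move=> x e s k s2; rewrite geq_max => /andP[_ he] H.
  eexists; first exact: ExecAssign.
  by move=> y yk; rewrite /upd (eval_agree he H) H.
- move=> c1 c2 s s1 s2 t1 t2 _ IH1 _ IH2 k r; rewrite geq_max => /andP[h1 h2] H.
  have [r1 x1 H1] := IH1 _ _ h1 H; have [r2 x2 H2] := IH2 _ _ h2 H1.
  by exists r2 => //; apply: ExecSeq x1 x2.
- move=> e c1 c2 s s1 t ev _ IH k r; rewrite !geq_max => /and3P[he h _] H.
  have [r1 x1 H1] := IH _ _ h H; exists r1 => //.
  by apply: ExecIfTrue => //; rewrite (eval_agree he H).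
- move=> e c1 c2 s s1 t ev _ IH k r; rewrite !geq_max => /and3P[he _ h] H.
  have [r1 x1 H1] := IH _ _ h H; exists r1 => //.
  by apply: ExecIfFalse => //; rewrite (eval_agree he H).
- move=> e c s s1 s2 t1 t2 ev _ IH1 _ IH2 k r h H.
  have /andP[he hc] : (evars e <= k) && (cvars c <= k) by rewrite -geq_max.
  have [r1 x1 H1] := IH1 _ _ hc H; have [r2 x2 H2] := IH2 _ _ h H1.
  by exists r2 => //; apply: ExecWhileTrue x1 x2; rewrite (eval_agree he H).
- move=> e c s ev k r; rewrite geq_max => /andP[he hc] H; exists r => //.
  by apply: ExecWhileFalse; rewrite (eval_agree he H).
Qed.

(** * Timed postconditions for programs *)

(** Exact costs are relaxed to an upper bound, so that both branches of a conditional and all rounds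
    of a loop can share one. *)
Definition runs (c : cmd) (s : store) (T : nat) (P : store -> Prop) : Prop :=
  exists t s', [/\ exec c s t s', t <= T & P s'].

Lemma runs_weak c s T T' (P Q : store -> Prop) :
  runs c s T P -> T <= T' -> (forall s', P s' -> Q s') -> runs c s T' Q.
Proof.
move=> [t [s' [x h p]]] TT PQ; exists t, s'; split => //; first exact: leq_trans TT.
exact: PQ.
Qed.

Lemma runs_frame c s T P : runs c s T P ->
  runs c s T (fun s' => P s' /\ forall y, cvars c <= y -> s' y = s y).
Proof.
move=> [t [s' [x h p]]]; exists t, s'; split => //; split => //.
exact: exec_frame x.
Qed.

Lemma runs_assign x e s (P : store -> Prop) :
  P (upd s x (eval e s)) -> runs (Assign x e) s (ecost e).+1 P.
Proof. by move=> p; exists (ecost e).+1, (upd s x (eval e s)); split=> //; constructor. Qed.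

Lemma runs_seq c1 c2 s T1 T2 P Q :
  runs c1 s T1 P -> (forall s1, P s1 -> runs c2 s1 T2 Q) ->
  runs (Seq c1 c2) s (T1 + T2).+1 Q.
Proof.
move=> [t1 [s1 [x1 h1 p1]]] /(_ _ p1) [t2 [s2 [x2 h2 p2]]].
exists (t1 + t2).+1, s2; split => //; first exact: ExecSeq x1 x2.
by rewrite ltnS leq_add.
Qed.

Lemma runs_if e c1 c2 s T P :
  (eval e s <> Leaf -> runs c1 s T P) -> (eval e s = Leaf -> runs c2 s T P) ->
  runs (If e c1 c2) s (ecost e + T).+1 P.
Proof.
case E: (eval e s) => [|a b] h1 h2.
  have [t [s' [x h p]]] := h2 erefl; exists (ecost e + t).+1, s'; split=> //.
    exact: ExecIfFalse.
  by rewrite ltnS leq_add2l.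
have [//|t [s' [x h p]]] := h1; exists (ecost e + t).+1, s'; split=> //.
  by apply: ExecIfTrue; rewrite // E.
by rewrite ltnS leq_add2l.
Qed.

(** * Sizes of encodings and polynomial bounds *)

Fixpoint tsize (t : tree) : nat :=
  if t is Node a b then (tsize a + tsize b).+1 else 0.

Class Enc (A : Type) := enc : A -> tree.
#[global] Instance enc_unit : Enc unit := fun=> Leaf.
#[global] Instance enc_boolE : Enc bool := enc_bool.
#[global] Instance enc_natE : Enc nat := enc_nat.
#[global] Instance enc_prod A B (eA : Enc A) (eB : Enc B) : Enc (A * B) :=
  fun p => Node (enc p.1) (enc p.2).
#[global] Instance enc_seqE A (eA : Enc A) : Enc (seq A) := enc_seq enc.

Definition sz {A} {eA : Enc A} (a : A) : nat := tsize (enc a).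

Lemma sz_pair A B {eA : Enc A} {eB : Enc B} (p : A * B) :
  sz p = (sz p.1 + sz p.2).+1.
Proof. by []. Qed.

Lemma sz_cons A {eA : Enc A} (a : A) l : sz (a :: l) = (sz a + sz l).+1.
Proof. by []. Qed.

Lemma sz_nil A {eA : Enc A} : sz ([::] : seq A) = 0.
Proof. by []. Qed.

Lemma sz_nat (n : nat) : sz n = n.
Proof. by elim: n => // n IH; congr _.+1. Qed.

Lemma sz_bool (b : bool) : sz b <= 1.
Proof. by case: b. Qed.

Lemma sz_seq A {eA : Enc A} (l : seq A) : sz l = \sum_(a <- l) (sz a).+1.
Proof. by elim: l => [|a l IH]; rewrite ?big_nil ?big_cons // sz_cons IH addSn. Qed.

Lemma sz_cat A {eA : Enc A} (s t : seq A) : sz (s ++ t) = sz s + sz t.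
Proof. by rewrite !sz_seq big_cat. Qed.

Lemma sz_rev A {eA : Enc A} (s : seq A) : sz (rev s) = sz s.
Proof.
by elim: s => // a s IH; rewrite rev_cons -cats1 sz_cat !sz_cons IH sz_nil; lia.
Qed.

Lemma size_sz A {eA : Enc A} (s : seq A) : size s <= sz s.
Proof. by elim: s => // a s IH; rewrite sz_cons /= ltnS (leq_trans IH) // leq_addl. Qed.

(** As the base is at least 2, one exponent absorbs all constants, and sums, products and powers
    need no bookkeeping of coefficients. *)
Definition pb {A} {eA : Enc A} (g : A -> nat) : Prop :=
  exists k, forall a, g a <= (sz a + 2) ^ k.

Section Pb.
Context {A : Type} {eA : Enc A}.
Implicit Types g h : A -> nat.

Lemma pb_le g h : pb h -> (forall a, g a <= h a) -> pb g.
Proof. by move=> [k H] gh; exists k => a; apply: leq_trans (gh a) (H a). Qed.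

Lemma pb_sz : pb (@sz A eA).
Proof. by exists 1 => a; rewrite expn1 leq_addr. Qed.

Lemma pb_const n : pb (fun=> n).
Proof.
exists n => a; apply: leq_trans (_ : 2 ^ n <= _); first exact/ltnW/ltn_expl.
by case: n => // n; rewrite leq_exp2r // leq_addl.
Qed.

Lemma pbM g h : pb g -> pb h -> pb (fun a => g a * h a).
Proof. by move=> [k G] [j H]; exists (k + j) => a; rewrite expnD leq_mul. Qed.

Lemma pbD g h : pb g -> pb h -> pb (fun a => g a + h a).
Proof.
move=> [k G] [j H]; exists (k + j).+1 => a.
have p i : 0 < (sz a + 2) ^ i by rewrite expn_gt0 addn2.
apply: leq_trans (_ : 2 * (sz a + 2) ^ (k + j) <= _); last first.
  by rewrite expnS leq_mul2r leq_addl orbT.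
rewrite mul2n -addnn expnD leq_add //.
  by apply: leq_trans (G a) _; rewrite leq_pmulr.
by apply: leq_trans (H a) _; rewrite leq_pmull.
Qed.

Lemma pbS g : pb g -> pb (fun a => (g a).+1).
Proof. by move=> G; apply: pb_le (pbD G (pb_const 1)) _ => a; rewrite addn1. Qed.

Lemma pbX g n : pb g -> pb (fun a => g a ^ n).
Proof. by move=> [k G]; exists (k * n) => a; rewrite expnM; case: n => // n; rewrite leq_exp2r. Qed.

Lemma pb_comp B {eB : Enc B} (T : B -> nat) (f : A -> B) :
  pb T -> pb (fun a => sz (f a)) -> pb (fun a => T (f a)).
Proof.
move=> [k H] F; apply: pb_le (pbX k (pbD F (pb_const 2))) _ => a; exact: H.
Qed.

End Pb.

(* Programs communicate through variable 0 and must work whatever the other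
   variables hold, so that they compose.  The size of the result is bounded
   separately, because sharing lets [t] steps build a tree of size [2 ^ t]. *)
Definition PT {A B} {eA : Enc A} {eB : Enc B} (f : A -> B) : Prop :=
  pb (fun a => sz (f a)) /\
  exists c T, pb T /\ forall a s, s 0 = enc a ->
    runs c s (T a) (fun s' => s' 0 = enc (f a)).

Section PTbase.
Context {A B C : Type} {eA : Enc A} {eB : Enc B} {eC : Enc C}.

Lemma PT_ext (f g : A -> B) : PT f -> (forall x, f x = g x) -> PT g.
Proof. by move=> ? /funext <-. Qed.

Lemma PT_sz (f : A -> B) : PT f -> pb (fun a => sz (f a)).
Proof. by case. Qed.

Lemma PT_comp (g : B -> C) (f : A -> B) : PT g -> PT f -> PT (fun x => g (f x)).
Proof.
move=> [G [c [T [pT H]]]] [F [c' [T' [pT' H']]]]; split.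
  exact: pb_comp G F.
exists (Seq c' c), (fun a => (T' a + T (f a)).+1); split.
  exact/pbS/pbD/pb_comp.
by move=> a s s0; apply: runs_seq (H' _ _ s0) _ => s1 s10; apply: H.
Qed.

Lemma PT_expr (f : A -> B) (e : expr) :
  (forall a s, s 0 = enc a -> eval e s = enc (f a)) ->
  pb (fun a => sz (f a)) -> PT f.
Proof.
move=> H p; split => //; exists (Assign 0 e), (fun=> (ecost e).+1); split.
  exact: pb_const.
by move=> a s s0; apply: runs_assign; rewrite /upd /= (H a).
Qed.

Lemma PT_pair (f : A -> B) (g : A -> C) : PT f -> PT g -> PT (fun x => (f x, g x)).
Proof.
move=> [F [c [T [pT H]]]] [G [c' [T' [pT' H']]]]; split.
  exact: (pbS (pbD F G)).
(* Neither program touches variables from [k] on: [k] keeps the input while [c] runs, [k.+1] keeps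
   the first result while [c'] runs. *)
pose k := (maxn (cvars c) (cvars c')).+1.
have kc : cvars c <= k by rewrite leqW // leq_maxl.
have kc' : cvars c' <= k.+1 by rewrite !leqW // leq_maxr.
exists (Seq (Assign k (EVar 0)) (Seq c (Seq (Assign k.+1 (EVar 0))
   (Seq (Assign 0 (EVar k)) (Seq c' (Assign 0 (ECons (EVar k.+1) (EVar 0)))))))).
exists (fun a => (2 + (T a + (2 + (2 + (T' a + 4).+1).+1).+1).+1).+1); split.
  by do ?[apply: pbS | apply: pbD | apply: pb_const | assumption].
move=> a s s0; apply: (runs_seq (runs_assign (P := fun s1 => s1 0 = enc a /\ s1 k = enc a) _)).
  by rewrite /upd /= eqxx.
move=> s1 [s10 s1k]; apply: (runs_seq (runs_frame (H _ _ s10))) => s2 [s20 fr].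
apply: (runs_seq (runs_assign (P := fun s3 => s3 k = enc a /\ s3 k.+1 = enc (f a)) _)).
  by rewrite /upd /= eqxx ltn_eqF // fr.
move=> s3 [s3k s3k1].
apply: (runs_seq (runs_assign (P := fun s4 => s4 0 = enc a /\ s4 k.+1 = enc (f a)) _)).
  by rewrite /upd /=.
move=> s4 [s40 s4k1]; apply: (runs_seq (runs_frame (H' _ _ s40))) => s5 [s50 fr'].
by apply: (runs_assign (e := ECons _ _)); rewrite /upd /= s50 fr' // s4k1.
Qed.

Lemma PT_if (b : A -> bool) (f g : A -> B) : PT b -> PT f -> PT g ->
  PT (fun x => if b x then f x else g x).
Proof.
move=> [_ [cb [Tb [pb_ Hb]]]] [F [c [T [pT H]]]] [G [c' [T' [pT' H']]]]; split.
  by apply: pb_le (pbD F G) _ => a; case: (b a); rewrite ?leq_addr ?leq_addl.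
pose k := (cvars cb).+1.
exists (Seq (Assign k (EVar 0)) (Seq cb (If (EVar 0)
   (Seq (Assign 0 (EVar k)) c) (Seq (Assign 0 (EVar k)) c')))).
exists (fun a => (2 + (Tb a + (1 + (2 + (T a + T' a)).+1).+1).+1).+1); split.
  by do ?[apply: pbS | apply: pbD | apply: pb_const | assumption].
move=> a s s0; apply: (runs_seq (runs_assign (P := fun s1 => s1 0 = enc a /\ s1 k = enc a) _)).
  by rewrite /upd /= eqxx.
move=> s1 [s10 s1k]; apply: (runs_seq (runs_frame (Hb _ _ s10))) => s2 [s20 fr].
apply: (runs_if (e := EVar 0)) => /=; rewrite s20; case: (b a) => // _.
  apply: (runs_seq (runs_assign (P := fun s3 => s3 0 = enc a) _)).
    by rewrite /upd /= fr.
  move=> s3 s30; apply: runs_weak (H _ _ s30) (leq_addr _ _) _ => //.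
apply: (runs_seq (runs_assign (P := fun s3 => s3 0 = enc a) _)).
  by rewrite /upd /= fr.
move=> s3 s30; apply: runs_weak (H' _ _ s30) (leq_addl _ _) _ => //.
Qed.

(* The accumulators must be bounded: a fold whose step is polynomial, such as
   doubling, may otherwise produce exponentially large values. *)
Lemma PT_foldl (f : A -> C -> B -> C) (z : A -> C) (l : A -> seq B) :
  PT (fun p : A * C * B => f p.1.1 p.1.2 p.2) -> PT z -> PT l ->
  (exists2 h, pb h & forall x s1 s2, l x = s1 ++ s2 ->
     sz (foldl (f x) (z x) s1) <= h x) ->
  PT (fun x => foldl (f x) (z x) (l x)).
Proof.
move=> [_ [cf [Tf [pf Hf]]]] [Z [cz [Tz [pz Hz]]]] [L [cl [Tl [pl Hl]]]] [h ph hh].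
split; first by apply: pb_le ph _ => x; apply: (hh x _ [::]); rewrite cats0.
have [k2 Hk2] := pf.
(* [k] will hold the input, [k.+1] the accumulator and [k.+2] the rest of the list. *)
pose k := (maxn (cvars cf) (maxn (cvars cz) (cvars cl))).+1.
have kf : cvars cf <= k by rewrite leqW // leq_maxl.
have kz : cvars cz <= k by rewrite leqW // leq_max leq_max leqnn orbT.
have kl : cvars cl <= k by rewrite leqW // leq_max leq_max leqnn !orbT.
pose body := Seq (Assign 0 (ECons (ECons (EVar k) (EVar k.+1)) (EHd (EVar k.+2))))
   (Seq cf (Seq (Assign k.+1 (EVar 0)) (Assign k.+2 (ETl (EVar k.+2))))).
exists (Seq (Assign k (EVar 0)) (Seq cl (Seq (Assign k.+2 (EVar 0))
   (Seq (Assign 0 (EVar k)) (Seq cz (Seq (Assign k.+1 (EVar 0))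
   (Seq (While (EVar k.+2) body) (Assign 0 (EVar k.+1))))))))).
(* The argument of a step consists of the input, an accumulator of size at most [h a] and one list
   element, so [M a] bounds the time of every step. *)
pose M a := (@sz A eA a + h a + @sz (seq B) (enc_seqE eB) (l a) + 4) ^ k2.
pose Tbody a := (7 + (M a + (2 + 3).+1).+1).+1.
exists (fun a => (2 + (Tl a + (2 + (2 + (Tz a + (2 + (((Tbody a + 2) * sz (l a) + 2) + 2).+1).+1).+1).+1).+1).+1).+1).
split.
  rewrite /Tbody /M.
  do ?[apply: pbS | apply: pbD | apply: pbM | apply: pbX | apply: pb_const | apply: pb_sz | assumption].
move=> a s s0.
apply: (runs_seq (runs_assign (P := fun s1 => s1 0 = enc a /\ s1 k = enc a) _)).
  by rewrite /upd /= eqxx.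
move=> {s s0} s [s0 sk]; apply: (runs_seq (runs_frame (Hl _ _ s0))) => s2 [s20 fr].
apply: (runs_seq (runs_assign (P := fun s3 => s3 k = enc a /\ s3 k.+2 = enc (l a)) _)).
  by rewrite /upd /= eqxx ltn_eqF // fr.
move=> {s s0 sk s2 s20 fr} s [sk skl].
apply: (runs_seq (runs_assign (P := fun s3 => [/\ s3 0 = enc a, s3 k = enc a & s3 k.+2 = enc (l a)]) _)).
  by rewrite /upd /=.
move=> {s sk skl} s [s0 sk skl]; apply: (runs_seq (runs_frame (Hz _ _ s0))) => s2 [s20 fr].
apply: (runs_seq (runs_assign (P := fun s3 => [/\ s3 k = enc a, s3 k.+1 = enc (z a) & s3 k.+2 = enc (l a)]) _)).
  by rewrite /upd /= eqxx ltn_eqF // gtn_eqF // (fr k) // (fr k.+2) //; do 2!apply: leqW.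
move=> {s sk skl s0 s2 s20 fr} s [sk sz_ skl].
apply: (runs_seq (P := fun s' => s' k.+1 = enc (foldl (f a) (z a) (l a)))); last first.
  by move=> s1 s1k; apply: (runs_assign (e := EVar _)); rewrite /upd /=.
have : forall s1 s2, l a = s1 ++ s2 -> forall s, s k = enc a ->
   s k.+1 = enc (foldl (f a) (z a) s1) -> s k.+2 = enc s2 ->
   runs (While (EVar k.+2) body) s ((Tbody a + 2) * size s2 + 2)
    (fun s' => s' k.+1 = enc (foldl (f a) (z a) (l a))).
  move=> {s sk sz_ skl} s1 s2; elim: s2 s1 => [|b s2 IH] s1 E s sk sa sl.
    exists 2, s; rewrite muln0; split=> //; last by rewrite E cats0.
    by apply: (ExecWhileFalse (e := EVar _)); rewrite /= sl.
  have [t1 [s' [x1 t1T [sk' sa' sl']]]] : runs body s (Tbody a) (fun s' =>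
     [/\ s' k = enc a, s' k.+1 = enc (foldl (f a) (z a) (rcons s1 b)) & s' k.+2 = enc s2]).
    apply: (runs_seq (runs_assign (P := fun s3 => [/\ s3 0 = enc (a, foldl (f a) (z a) s1, b),
       s3 k = enc a & s3 k.+2 = enc (b :: s2)]) _)).
      by rewrite /upd /= sk sa sl.
    move=> {sk sa sl} s' [s0 sk sl].
    apply: (runs_seq (runs_weak (runs_frame (Hf _ _ s0)) (_ : _ <= M a) (fun _ x => x))).
      apply: leq_trans (Hk2 _) _; rewrite /M; case: (k2) => // k3.
      rewrite leq_exp2r // !sz_pair /=.
      have := hh _ _ _ E; have : sz b <= sz (l a) by rewrite E sz_cat sz_cons; lia.
      lia.
    move=> s3 [s30 fr].
    apply: (runs_seq (runs_assign (P := fun s3 => [/\ s3 k = enc a,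
      s3 k.+1 = enc (foldl (f a) (z a) (rcons s1 b)) & s3 k.+2 = enc (b :: s2)]) _)).
      by rewrite /upd /= eqxx ltn_eqF // gtn_eqF // s30 (fr k) // (fr k.+2) ?foldl_rcons //; do 2!apply: leqW.
    move=> s4 [s4k s4a s4l]; apply: (runs_assign (e := ETl (EVar _))).
    by rewrite /upd /= s4l eqxx [k == _]ltn_eqF // [k.+1 == _]ltn_eqF.
  have E' : l a = rcons s1 b ++ s2 by rewrite cat_rcons.
  have [t2 [s'' [x2 t2T H]]] := IH _ E' _ sk' sa' sl'.
  exists (1 + t1 + t2).+1, s''; split => //.
    by apply: (ExecWhileTrue (e := EVar _)) x1 x2; rewrite /= sl.
  rewrite /= mulnS; lia.
move=> /(_ [::] (l a) erefl s sk sz_ skl) /runs_weak; apply => //.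
by rewrite leq_add2r leq_mul // size_sz.
Qed.

End PTbase.

Section PTbase2.
Context {A B C : Type} {eA : Enc A} {eB : Enc B} {eC : Enc C}.

Lemma PT_id : PT (fun x : A => x).
Proof. by apply: (PT_expr (e := EVar 0)) => //; apply: pb_sz. Qed.

Lemma PT_const (b : B) : PT (fun _ : A => b).
Proof.
pose texpr := fix texpr t := if t is Node a b then ECons (texpr a) (texpr b) else ENil.
apply: (PT_expr (e := texpr (enc b))); last exact: pb_const.
by move=> _ s _; elim: (enc b) => //= t1 -> t2 ->.
Qed.

(** Programs see trees, not types. This identifies a number with the list of that many units, so
    arithmetic reduces to list operations. *)
Lemma PT_conv (f : A -> B) (g : A -> C) :
  PT f -> (forall x, enc (g x) = enc (f x)) -> PT g.
Proof.
move=> [F [c [T [pT H]]]] E; split; first by apply: pb_le F _ => x; rewrite /sz E.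
by exists c, T; split => // a s s0; rewrite E; apply: H.
Qed.

Lemma PT_fst (f : A -> B * C) : PT f -> PT (fun x => (f x).1).
Proof.
apply: (PT_comp (g := fst)); apply: (PT_expr (e := EHd (EVar 0))) => [a s /= ->//|].
by apply: pb_le pb_sz _ => a; rewrite [sz a]sz_pair; lia.
Qed.

Lemma PT_snd (f : A -> B * C) : PT f -> PT (fun x => (f x).2).
Proof.
apply: (PT_comp (g := snd)); apply: (PT_expr (e := ETl (EVar 0))) => [a s /= ->//|].
by apply: pb_le pb_sz _ => a; rewrite [sz a]sz_pair; lia.
Qed.

Lemma PT_cons (f : A -> B) (l : A -> seq B) :
  PT f -> PT l -> PT (fun x => f x :: l x).
Proof.
move=> F L; have [P [c [T [pT H]]]] := PT_pair F L.
by split => //; exists c, T.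
Qed.

Lemma PT_behead (l : A -> seq B) : PT l -> PT (fun x => behead (l x)).
Proof.
apply: (PT_comp (g := behead)).
apply: (PT_expr (e := ETl (EVar 0))) => [[|b l0] s /= ->//|].
by apply: pb_le pb_sz _ => -[|b s] //=; rewrite sz_cons; lia.
Qed.

Lemma PT_comp2 D (eD : Enc D) (h : B -> C -> D) (f : A -> B) (g : A -> C) :
  PT (fun p : B * C => h p.1 p.2) -> PT f -> PT g -> PT (fun x => h (f x) (g x)).
Proof. by move=> H F G; apply: PT_comp H (PT_pair F G). Qed.

End PTbase2.

(** * Lists, numbers and equality tests in polynomial time *)

Section PTseq.
Context {A B C : Type} {eA : Enc A} {eB : Enc B} {eC : Enc C}.

Lemma PT_catrev (l m : A -> seq B) : PT l -> PT m -> PT (fun x => catrev (l x) (m x)).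
Proof.
move=> L M.
have E (s z : seq B) : foldl (fun acc y => y :: acc) z s = catrev s z.
  by elim: s z => //= y s IH z; rewrite IH.
apply: (PT_ext (f := fun x => foldl (fun acc y => y :: acc) (m x) (l x))) => //.
apply: (PT_foldl (f := fun _ acc y => y :: acc)) => //.
  by apply: PT_cons; [apply/PT_snd/PT_id | apply/PT_snd/PT_fst/PT_id].
exists (fun x => sz (l x) + sz (m x)); first by apply: pbD; apply: PT_sz.
by move=> x s1 s2 ->; rewrite E catrevE !sz_cat sz_rev; lia.
Qed.

Lemma PT_rev (l : A -> seq B) : PT l -> PT (fun x => rev (l x)).
Proof. by move=> L; apply: PT_catrev => //; apply: PT_const. Qed.

Lemma PT_cat (l m : A -> seq B) : PT l -> PT m -> PT (fun x => l x ++ m x).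
Proof.
move=> L M; apply: (PT_ext (PT_catrev (PT_rev L) M)) => x.
by rewrite catrevE revK.
Qed.
End PTseq.

Section PTseq2.
Context {A B C : Type} {eA : Enc A} {eB : Enc B} {eC : Enc C}.

Lemma PT_foldr (f : A -> B -> C -> C) (z : A -> C) (l : A -> seq B) :
  PT (fun p : A * C * B => f p.1.1 p.2 p.1.2) -> PT z -> PT l ->
  (exists2 h, pb h & forall x s1 s2, l x = s1 ++ s2 ->
     sz (foldr (f x) (z x) s2) <= h x) ->
  PT (fun x => foldr (f x) (z x) (l x)).
Proof.
move=> F Z L [h ph H].
apply: (PT_ext (f := fun x => foldl (fun c b => f x b c) (z x) (rev (l x)))); last first.
  by move=> x; rewrite foldl_rev.
apply: (PT_foldl (f := fun x c b => f x b c)) => //; first exact: PT_rev.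
exists h => // x s1 s2 E.
rewrite -{1}[s1]revK foldl_rev; apply: (H _ (rev s2)).
by rewrite -rev_cat -E revK.
Qed.

End PTseq2.

Section PTseq2b.
Context {A B C : Type} {eA : Enc A} {eB : Enc B} {eC : Enc C}.

Lemma PT_head (d : A -> B) (l : A -> seq B) : PT d -> PT l ->
  PT (fun x => head (d x) (l x)).
Proof.
move=> D L; apply: (PT_ext (f := fun x => foldr (fun b _ => b) (d x) (l x))); last first.
  by move=> x; case: (l x).
apply: (PT_foldr (f := fun _ b _ => b)) => //; first exact/PT_snd/PT_id.
exists (fun x => sz (d x) + sz (l x)); first by apply: pbD; apply: PT_sz.
move=> x s1 [|b s2] -> /=; first lia.
by rewrite sz_cat sz_cons; lia.
Qed.

Lemma PT_nilp (l : A -> seq B) : PT l -> PT (fun x => nilp (l x)).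
Proof.
move=> L; apply: (PT_ext (f := fun x => foldr (fun _ _ => false) true (l x))); last first.
  by move=> x; case: (l x).
apply: (PT_foldr (f := fun _ _ _ => false) (z := fun=> true)) => //; try exact: PT_const.
by exists (fun=> 1); [exact: pb_const | move=> x s1 [|]].
Qed.

Lemma PT_map (f : A -> B -> C) (l : A -> seq B) :
  PT (fun p : A * B => f p.1 p.2) -> PT l -> PT (fun x => map (f x) (l x)).
Proof.
move=> F L.
apply: (PT_ext (f := fun x => foldr (fun b acc => f x b :: acc) [::] (l x))) => //.
apply: (PT_foldr (f := fun x b acc => f x b :: acc)) => //; last 1 first.
- have [[k Hk] _] := F.
  exists (fun x => (((sz x + sz (l x) + 3) ^ k).+1) * sz (l x)).
    by do ?[apply: pbS | apply: pbD | apply: pbM | apply: pbX | apply: pb_const | apply: pb_sz]; apply: PT_sz L.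
  move=> x s1 s2 E.
  have {}E : sz s2 <= sz (l x) by rewrite E sz_cat leq_addl.
  apply: leq_trans (_ : (((sz x + sz (l x) + 3) ^ k).+1) * size s2 <= _); last first.
    by rewrite leq_mul2l (leq_trans (size_sz _) E) orbT.
  elim: s2 E => // b s2 IH; rewrite sz_cons /= => E.
  rewrite sz_cons mulnS -addSn leq_add //; last by apply: IH; lia.
  rewrite ltnS; apply: leq_trans (Hk (x, b)) _; case: (k) => // k'.
  by rewrite leq_exp2r // sz_pair /=; lia.
- apply: PT_cons; last exact/PT_snd/PT_fst/PT_id.
  by apply: (PT_comp2 F); [exact/PT_fst/PT_fst/PT_id | exact/PT_snd/PT_id].
- exact: PT_const.
Qed.

Lemma PT_flatten (l : A -> seq (seq B)) : PT l -> PT (fun x => flatten (l x)).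
Proof.
move=> L; apply: (PT_foldr (f := fun _ => cat) (z := fun=> [::])) => //.
- by apply: PT_cat; [exact/PT_snd/PT_id | exact/PT_snd/PT_fst/PT_id].
- exact: PT_const.
exists (fun x => sz (l x)); first exact: PT_sz.
move=> x s1 s2 ->; rewrite [in X in _ <= X]sz_cat.
apply: leq_trans (leq_addl _ _); elim: s2 => //= s s2 IH.
by rewrite sz_cat sz_cons -addnS leq_add // leqW.
Qed.

Lemma PT_filter (p : A -> B -> bool) (l : A -> seq B) :
  PT (fun q : A * B => p q.1 q.2) -> PT l -> PT (fun x => [seq b <- l x | p x b]).
Proof.
move=> P L; apply: (PT_foldr (f := fun x b acc => if p x b then b :: acc else acc) (z := fun=> [::])) => //.
- apply: PT_if.
  + by apply: (PT_comp2 P); [exact/PT_fst/PT_fst/PT_id | exact/PT_snd/PT_id].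
  + by apply: PT_cons; [exact/PT_snd/PT_id | exact/PT_snd/PT_fst/PT_id].
  + exact/PT_snd/PT_fst/PT_id.
- exact: PT_const.
exists (fun x => sz (l x)); first exact: PT_sz.
move=> x s1 s2 ->; rewrite sz_cat.
apply: leq_trans (leq_addl _ _); elim: s2 => //= s s2 IH.
by case: ifP => _; rewrite ?sz_cons; lia.
Qed.

Lemma PT_negb (p : A -> bool) : PT p -> PT (fun x => ~~ p x).
Proof. by move=> P; apply: (PT_if P); apply: PT_const. Qed.

Lemma PT_andb (p q : A -> bool) : PT p -> PT q -> PT (fun x => p x && q x).
Proof. by move=> P Q; apply: (PT_if P) => //; apply: PT_const. Qed.

Lemma PT_orb (p q : A -> bool) : PT p -> PT q -> PT (fun x => p x || q x).
Proof. by move=> P Q; apply: (PT_if P) => //; apply: PT_const. Qed.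

End PTseq2b.

Section PTseq3.
Context {A B C : Type} {eA : Enc A} {eB : Enc B} {eC : Enc C}.

Lemma PT_has (p : A -> B -> bool) (l : A -> seq B) :
  PT (fun q : A * B => p q.1 q.2) -> PT l -> PT (fun x => has (p x) (l x)).
Proof.
move=> P L; apply: (PT_ext (PT_negb (PT_nilp (PT_filter P L)))) => x.
by rewrite has_count /nilp size_filter lt0n.
Qed.

Lemma PT_nseq (n : A -> nat) : PT n -> PT (fun x => nseq (n x) tt).
Proof. by move=> N; apply: (PT_conv N) => x; elim: (n x) => // k IH; apply: (congr1 (Node Leaf) IH). Qed.

Lemma PT_size (l : A -> seq B) : PT l -> PT (fun x => size (l x)).
Proof.
move=> L; apply: (PT_conv (PT_map (f := fun _ _ => tt) (PT_const _) L)) => x.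
by elim: (l x) => // a s IH; apply: (congr1 (Node Leaf) IH).
Qed.

Lemma PT_drop (n : A -> nat) (l : A -> seq B) : PT n -> PT l ->
  PT (fun x => drop (n x) (l x)).
Proof.
move=> N L.
have E m (s : seq B) : drop m s = foldr (fun _ => behead) s (nseq m tt).
  by elim: m => [|m /= <-]; [rewrite drop0 | rewrite -drop1 drop_drop].
apply: (PT_ext (f := fun x => foldr (fun _ => behead) (l x) (nseq (n x) tt))) => //.
apply: (PT_foldr (f := fun _ _ => behead)) => //; last 1 first.
- exists (fun x => sz (l x)); first exact: PT_sz.
  move=> x s1 s2 _; elim: s2 => //= _ s2; apply: leq_trans.
  by case: (foldr _ _ _) => //= b s; rewrite sz_cons; lia.
- exact/PT_behead/PT_snd/PT_fst/PT_id.
- exact: PT_nseq.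
Qed.

Lemma PT_nth (d : A -> B) (n : A -> nat) (l : A -> seq B) : PT d -> PT n -> PT l ->
  PT (fun x => nth (d x) (l x) (n x)).
Proof.
move=> D N L; apply: (PT_ext (PT_head D (PT_drop N L))) => x.
by elim: (n x) (l x) => [|m IH] [|b s] //=.
Qed.

End PTseq3.

Section PTnat.
Context {A B C : Type} {eA : Enc A} {eB : Enc B} {eC : Enc C}.

Lemma PT_addn (m n : A -> nat) : PT m -> PT n -> PT (fun x => m x + n x).
Proof.
move=> M N; apply: (PT_ext (PT_size (PT_cat (PT_nseq M) (PT_nseq N)))) => x.
by rewrite size_cat !size_nseq.
Qed.

Lemma PT_succ (m : A -> nat) : PT m -> PT (fun x => (m x).+1).
Proof.
by move=> M; apply: (PT_ext (PT_addn M (PT_const 1))) => x; rewrite addn1.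
Qed.

Lemma PT_subn (m n : A -> nat) : PT m -> PT n -> PT (fun x => m x - n x).
Proof.
move=> M N; apply: (PT_ext (PT_size (PT_drop N (PT_nseq M)))) => x.
by rewrite size_drop !size_nseq.
Qed.

Lemma PT_muln (m n : A -> nat) : PT m -> PT n -> PT (fun x => m x * n x).
Proof.
move=> M N; apply: (PT_ext (PT_size (PT_flatten
  (PT_map (f := fun x _ => nseq (n x) tt) (PT_nseq (PT_comp N (PT_fst PT_id))) (PT_nseq M))))) => x.
by rewrite size_flatten /shape -map_comp; elim: (m x) => // k /= ->; rewrite size_nseq mulSn.
Qed.

Lemma PT_leq (m n : A -> nat) : PT m -> PT n -> PT (fun x => m x <= n x).
Proof.
move=> M N; apply: (PT_ext (PT_nilp (PT_drop N (PT_nseq M)))) => x.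
by rewrite /nilp size_drop size_nseq.
Qed.

Lemma sz_iota m n : sz (iota m n) <= n * (m + n).+1.
Proof.
elim: n m => // n IH m; rewrite -[iota m n.+1]/(m :: iota m.+1 n) sz_cons sz_nat mulSn.
have := IH m.+1; rewrite addSnnS; lia.
Qed.

Lemma PT_iota (n : A -> nat) : PT n -> PT (fun x => iota 0 (n x)).
Proof.
have E m : foldr (fun _ acc => size acc :: acc) [::] (nseq m tt) = rev (iota 0 m).
  by elim: m => // m IH; rewrite -[in RHS]addn1 iotaD rev_cat /= IH size_rev size_iota.
move=> N; apply: (PT_ext (f := fun x => rev (foldr (fun _ acc => size acc :: acc) [::] (nseq (n x) tt)))); last first.
  by move=> x; rewrite E revK.
apply: PT_rev; apply: (PT_foldr (f := fun _ _ acc => size acc :: acc) (z := fun=> [::])).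
- by apply: PT_cons; [apply: PT_size|]; apply/PT_snd/PT_fst/PT_id.
- exact: PT_const.
- exact: PT_nseq.
exists (fun x => sz (n x) * (sz (n x)).+1).
  by apply: pbM; [|apply: pbS]; apply: PT_sz N.
move=> x s1 s2 E'; have -> : s2 = nseq (size s2) tt.
  by elim: (s2) => // -[] s /= <-.
rewrite E sz_rev (leq_trans (sz_iota _ _)) //= add0n sz_nat.
have : size s2 <= n x by rewrite -(size_nseq (n x) tt) E' size_cat leq_addl.
by move=> H; apply: leq_mul.
Qed.

End PTnat.

(** The language has no equality test, so equality is shown computable type by type. *)
Definition PTeq (T : eqType) {eT : Enc T} : Prop := PT (fun p : T * T => p.1 == p.2).
Arguments PTeq T {eT}.

Section PTeq.
Context {A : Type} {eA : Enc A} {T : eqType} {eT : Enc T}.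

Lemma PT_eq (f g : A -> T) : PTeq T -> PT f -> PT g -> PT (fun x => f x == g x).
Proof. by move=> E F G; apply: (PT_comp E (PT_pair F G)). Qed.

End PTeq.

Section PTeq2.
Context {A : Type} {eA : Enc A} {T : eqType} {eT : Enc T}.

Lemma PT_mem (f : A -> T) (l : A -> seq T) :
  PTeq T -> PT f -> PT l -> PT (fun x => f x \in l x).
Proof.
move=> E F L; apply: (PT_ext (f := fun x => has (fun y => f x == y) (l x))).
  apply: PT_has => //; apply: PT_eq => //; last exact/PT_snd/PT_id.
  exact/(PT_comp F)/PT_fst/PT_id.
by move=> x; apply/hasP/idP => [[y yl /eqP->]|fl] //; exists (f x).
Qed.

End PTeq2.

Lemma PT_undup {A : Type} {eA : Enc A} {T : eqType} {eT : Enc T} (l : A -> seq T) : PTeq T -> PT l -> PT (fun x => undup (l x)).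
Proof.
move=> E L.
have F s : foldr (fun y (acc : seq T) => if y \in acc then acc else y :: acc) [::] s = undup s.
  by elim: s => //= y s ->; rewrite mem_undup.
apply: (PT_ext (f := fun x => foldr (fun y (acc : seq T) => if y \in acc then acc else y :: acc) [::] (l x))) => //.
apply: (PT_foldr (f := fun _ y (acc : seq T) => if y \in acc then acc else y :: acc) (z := fun=> [::])) => //.
- apply: PT_if.
  + by apply: PT_mem => //; [exact/PT_snd/PT_id | exact/PT_snd/PT_fst/PT_id].
  + exact/PT_snd/PT_fst/PT_id.
  by apply: PT_cons; [exact/PT_snd/PT_id | exact/PT_snd/PT_fst/PT_id].
- exact: PT_const.
exists (fun x => sz (l x)); first exact: PT_sz.
move=> x s1 s2 ->; rewrite sz_cat F; apply: leq_trans (leq_addl _ _).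
by elim: s2 => //= y s2 IH; case: ifP => _; rewrite ?sz_cons; lia.
Qed.

Lemma PTeq_unit : PTeq unit.
Proof. by apply: (PT_ext (PT_const true)) => -[[] []]. Qed.

Lemma PTeq_bool : PTeq bool.
Proof.
apply: (PT_ext (PT_if (PT_fst PT_id) (PT_snd PT_id) (PT_negb (PT_snd PT_id)))).
by case=> -[] [].
Qed.

Lemma PTeq_prod (T1 T2 : eqType) {e1 : Enc T1} {e2 : Enc T2} :
  PTeq T1 -> PTeq T2 -> PTeq (T1 * T2)%type.
Proof.
move=> E1 E2; apply: (PT_ext (f := fun p : (T1 * T2) * (T1 * T2) =>
  (p.1.1 == p.2.1) && (p.1.2 == p.2.2))); last by case=> -[? ?] [? ?].
apply: PT_andb; apply: PT_eq => //.
- exact/PT_fst/PT_fst/PT_id.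
- exact/PT_fst/PT_snd/PT_id.
- exact/PT_snd/PT_fst/PT_id.
- exact/PT_snd/PT_snd/PT_id.
Qed.

Lemma PTeq_seq (T : eqType) {eT : Enc T} : PTeq T -> PTeq (seq T).
Proof.
move=> E.
(* The fold over the second list keeps a flag, whether all elements matched so far, and the rest of
   the first list; the lists are equal when the flag survives and nothing is left. *)
pose f (r : bool * seq T) y :=
  (r.1 && (if nilp r.2 then false else head y r.2 == y), behead r.2).
have H s t b : (foldl f (b, t) s).1 && nilp (foldl f (b, t) s).2 = b && (t == s).
  elim: s t b => [|y s IH] [|z t] b //; rewrite -[foldl f _ (y :: s)]/(foldl f (f _ y) s) /f IH /=.
    by rewrite !andbF.
  by rewrite -andbA eqseq_cons.
apply: (PT_ext (f := fun p : seq T * seq T =>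
   (foldl f (true, p.1) p.2).1 && nilp (foldl f (true, p.1) p.2).2)); last first.
  by move=> p; rewrite H.
enough (F : PT (fun p : seq T * seq T => foldl f (true, p.1) p.2)).
  by apply: PT_andb; [apply: PT_fst | apply/PT_nilp/PT_snd].
apply: (PT_foldl (f := fun _ => f) (z := fun p : seq T * seq T => (true, p.1)) (l := fun p => p.2)).
- apply: PT_pair; last exact/PT_behead/PT_snd/PT_snd/PT_fst/PT_id.
  apply: PT_andb; first exact/PT_fst/PT_snd/PT_fst/PT_id.
  apply: PT_if; first exact/PT_nilp/PT_snd/PT_snd/PT_fst/PT_id.
    exact: PT_const.
  apply: PT_eq => //; last exact/PT_snd/PT_id.
  by apply: PT_head; [exact/PT_snd/PT_id | exact/PT_snd/PT_snd/PT_fst/PT_id].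
- by apply: PT_pair; [exact: PT_const | exact/PT_fst/PT_id].
- exact/PT_snd/PT_id.
exists (fun p => (sz p.1 + 1).+1).
  by apply: pbS; apply: pbD; [apply/PT_sz/PT_fst/PT_id | apply: pb_const].
move=> [t s] s1 s2 /= _; elim: s1 true t => [|y s1 IH] b t /=.
  by rewrite sz_pair /=; have := sz_bool b; lia.
apply: leq_trans (IH _ _) _; case: t => //= z t; rewrite sz_cons; lia.
Qed.

Lemma PTeq_nat : PTeq nat.
Proof.
apply: (PT_ext (f := fun p : nat * nat => nseq p.1 tt == nseq p.2 tt)).
  by apply: PT_eq; [exact/PTeq_seq/PTeq_unit| |];
    apply: PT_nseq; [apply: PT_fst | apply: PT_snd]; apply: PT_id.
move=> [m n] /=; apply/eqP/eqP => [/(congr1 size)|->//]; by rewrite !size_nseq.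
Qed.

Ltac pteq := repeat first
  [ assumption | exact PTeq_nat | exact PTeq_bool | exact PTeq_unit
  | apply PTeq_prod | apply PTeq_seq ].

(** Polynomial time is read off the syntax of a function; a subterm that matches no known operation
    passes only if it is independent of the argument. *)
Ltac pt1 := lazymatch goal with
  | |- PT (fun x => x) => exact PT_id
  | |- PT fst => exact (PT_fst PT_id)
  | |- PT snd => exact (PT_snd PT_id)
  | |- PT (fun x => (_, _)) => apply PT_pair
  | |- PT (fun x => fst _) => apply PT_fst
  | |- PT (fun x => snd _) => apply PT_snd
  | |- PT (fun x => if _ then _ else _) => apply PT_if
  | |- PT (fun x => _ && _) => apply PT_andb
  | |- PT (fun x => _ || _) => apply PT_orb
  | |- PT (fun x => ~~ _) => apply PT_negb
  | |- PT (fun x => cons _ _) => apply PT_cons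
  | |- PT (fun x => cat _ _) => apply PT_cat
  | |- PT (fun x => behead _) => apply PT_behead
  | |- PT (fun x => rev _) => apply PT_rev
  | |- PT (fun x => flatten _) => apply PT_flatten
  | |- PT (fun x => nilp _) => apply PT_nilp
  | |- PT (fun x => size _) => apply PT_size
  | |- PT (fun x => head _ _) => apply PT_head
  | |- PT (fun x => nth _ _ _) => apply PT_nth
  | |- PT (fun x => iota 0 _) => apply PT_iota
  | |- PT (fun x => undup _) => apply PT_undup; [pteq|]
  | |- PT (fun x => S _) => apply PT_succ
  | |- PT (fun x => addn _ _) => apply PT_addn
  | |- PT (fun x => subn _ _) => apply PT_subn
  | |- PT (fun x => muln _ _) => apply PT_muln
  | |- PT (fun x => leq _ _) => apply PT_leq
  | |- PT (fun x => eq_op _ _) => apply PT_eq; [pteq| |]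
  | |- PT (fun x => _ \in mem_seq _) => apply PT_mem; [pteq| |]
  | |- PT (fun x => _ \in _) => apply PT_mem; [pteq| |]
  | |- PT (fun x => has (@?p x) (@?l x)) => apply (PT_has (p := p) (l := l))
  | |- PT (fun x => map (@?p x) (@?l x)) => apply (PT_map (f := p) (l := l))
  | |- PT (fun x => seq.filter (@?p x) (@?l x)) => apply (PT_filter (p := p) (l := l))
  | |- _ => exact (PT_const _)
  end; cbv beta.
Ltac pt := repeat (first [assumption | pt1]).

(** * Sparsification *)

Notation lit := (nat * bool)%type.
Notation triple := (lit * lit * lit)%type.
Notation state := (seq lit * seq (lit * lit))%type.

Definition lits (N : nat) : seq lit := [seq (v, b) | v <- iota 0 N, b <- [:: true; false]].

Lemma mem_lits N (l : lit) : (l \in lits N) = (l.1 < N).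
Proof.
apply/allpairsP/idP => [[[v b] /= [+ _ ->]]|lN]; first by rewrite mem_iota.
by exists l; split; [rewrite mem_iota | case: (l.2) | case: (l)].
Qed.

Lemma uniq_lits N : uniq (lits N).
Proof. by apply: allpairs_uniq; rewrite ?iota_uniq // => -[? ?] [? ?] _ _ [-> ->]. Qed.

Lemma size_lits N : size (lits N) = N * 2.
Proof. by rewrite size_allpairs size_iota. Qed.

(* Pairs and triples are stored in every order of their components, so that
   occurrences can be counted in the first component. *)
Definition nbrs (U : seq lit) (B : seq (lit * lit)) (l : lit) : seq lit :=
  [seq p.2 | p <- B & (p.1 == l) && (p.2 \notin U)].

Definition blive (U : seq lit) (B : seq (lit * lit)) : seq (lit * lit) :=
  [seq p <- B | (p.1 \notin U) && (p.2 \notin U)].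

(** The triples not yet implied by a unit clause or a 2-clause. Testing each pair of components in
    one order suffices because [B] will be closed under [swap]. *)
Definition tlive (U : seq lit) (B : seq (lit * lit)) (T : seq triple) : seq triple :=
  [seq t <- T | [&& t.1.1 \notin U, t.1.2 \notin U, t.2 \notin U,
     t.1 \notin B, (t.1.1, t.2) \notin B & (t.1.2, t.2) \notin B]].

Definition thirds U B T (p : lit * lit) : seq lit :=
  [seq t.2 | t <- tlive U B T & t.1 == p].

Definition links U B T (l : lit) : seq (lit * lit) :=
  [seq (t.1.2, t.2) | t <- tlive U B T & t.1.1 == l].

Definition swap (p : lit * lit) : lit * lit := (p.2, p.1).

(** As in the two definitions that follow, an entry branches on clauses with a common part: an
    assignment satisfies them all exactly when it satisfies the common part or all the
    remainders. *)
Definition branch1 (t1 N : nat) (U : seq lit) (B : seq (lit * lit)) : seq (state * state) :=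
  [seq ((l :: U, B), (nbrs U B l ++ U, B))
     | l <- lits N & (l \notin U) && (t1 <= size (nbrs U B l))].

(** [undup] matters when both components of [p] are equal, as padded clauses may cause; the list of
    pairs has to stay free of duplicates. *)
Definition branch2 (t1 N : nat) T (U : seq lit) (B : seq (lit * lit)) : seq (state * state) :=
  [seq ((U, undup [:: p; swap p] ++ B), (thirds U B T p ++ U, B))
     | p <- [seq (a, b) | a <- lits N, b <- lits N] & t1 <= size (thirds U B T p)].

Definition branch3 (t2 N : nat) T (U : seq lit) (B : seq (lit * lit)) : seq (state * state) :=
  [seq ((l :: U, B), (U, links U B T l ++ B))
     | l <- lits N & t2 <= size (links U B T l)].

Definition branches (t1 t2 N : nat) T (s : state) : seq (state * state) :=
  branch1 t1 N s.1 s.2 ++ branch2 t1 N T s.1 s.2 ++ branch3 t2 N T s.1 s.2.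

Lemma count_leq3 (T : Type) (a b c d : pred T) (s : seq T) :
  (forall x, a x -> [|| b x, c x | d x]) ->
  count a s <= count b s + count c s + count d s.
Proof.
move=> H; elim: s => //= x s IH; have := H x.
by case: (a x) (b x) (c x) (d x) => [] [] [] []; lia.
Qed.

Lemma size_sum_count (T T' : eqType) (f : T -> T') (L : seq T') (s : seq T) :
  uniq L -> (forall x, x \in s -> f x \in L) ->
  size s = \sum_(l <- L) count (fun x => f x == l) s.
Proof.
move=> uL; elim: s => [|x s IH] H; first by rewrite big1.
rewrite /= IH; last by move=> y ys; apply: H; rewrite inE ys orbT.
rewrite big_split /= -[LHS]add1n; congr (_ + _).
rewrite (bigD1_seq (f x)) //=; last by rewrite H ?mem_head.
by rewrite eqxx big1 // => l; rewrite eq_sym => /negPf->.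
Qed.

Lemma count_involution (X : eqType) (f : X -> X) (a : pred X) (s : seq X) :
  involutive f -> uniq s -> (forall x, x \in s -> f x \in s) ->
  count (fun x => a (f x)) s = count a s.
Proof.
move=> fK us fs; have /permP/(_ a) : perm_eq (map f s) s; last by rewrite count_map.
apply: uniq_perm => //; first by rewrite (map_inj_uniq (inv_inj fK)).
move=> x; apply/mapP/idP => [[y ys ->]|xs]; first exact: fs.
by exists (f x); [apply: fs | rewrite fK].
Qed.

Section Sparsify.
Variables (t1 t2 N : nat) (T : seq triple).
Hypotheses (t1_gt0 : 0 < t1) (t2_gt0 : 0 < t2).

Definition wfT : Prop :=
  [/\ uniq T, forall t, t \in T -> [&& t.1.1 \in lits N, t.1.2 \in lits N & t.2 \in lits N],
      forall a b c, (a, b, c) \in T -> (b, a, c) \in T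
    & forall a b c, (a, b, c) \in T -> (a, c, b) \in T].

Definition wf (s : state) : Prop :=
  [/\ uniq s.1 && uniq s.2, {subset s.1 <= lits N},
      forall p, p \in s.2 -> (p.1 \in lits N) && (p.2 \in lits N),
      forall p, p \in s.2 -> swap p \in s.2
    & forall l, l \notin s.1 -> size (nbrs s.1 s.2 l) <= 2 * t1].

(** An unforced literal is worth [8 * t1], a live pair costs 1. With at most [2 * t1] live pairs per
    unforced literal the subtraction never truncates. Forcing a literal destroys at most [4 * t1]
    ordered pairs, so the potential drops by at least [4 * t1]. *)
Definition mu (s : state) : nat :=
  8 * t1 * (N * 2 - size s.1) - size (blive s.1 s.2).

Lemma size_nbrs U B l :
  size (nbrs U B l) = count (fun p => (p.1 == l) && (p.2 \notin U)) B.
Proof. by rewrite size_map size_filter. Qed.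

Lemma count_swap (B : seq (lit * lit)) (a : pred (lit * lit)) :
  uniq B -> (forall p, p \in B -> swap p \in B) ->
  count (fun p => a (swap p)) B = count a B.
Proof. by apply: count_involution; case. Qed.

(** Double counting: a live pair is charged to its first component, an unforced literal of degree at
    most [2 * t1]. *)
Lemma size_live s : wf s -> size (blive s.1 s.2) <= 2 * t1 * (N * 2 - size s.1).
Proof.
move: s => [U B] [/= /andP[uU uB] UL BL Bs deg].
rewrite (@size_sum_count _ _ fst (lits N)); last 2 first.
- exact: uniq_lits.
- by move=> p; rewrite mem_filter => /andP[_ /BL /andP[]].
have -> : N * 2 - size U = count (fun l => l \notin U) (lits N).
  have : perm_eq [seq l <- lits N | l \in U] U.
    apply: uniq_perm => //; first by rewrite filter_uniq // uniq_lits.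
    by move=> l; rewrite mem_filter andb_idr //; apply: UL.
  move/perm_size; rewrite size_filter => <-.
  by rewrite -size_lits -(count_predC [in U]) addKn.
have sumE : forall L : seq lit, \sum_(l <- L | l \notin U) 1 = count (fun l => l \notin U) L.
  by move=> L; rewrite -big_filter sum1_size size_filter.
rewrite -sumE big_distrr /= (bigID (fun l => l \in U)) /= big1 ?add0n.
  apply: leq_sum => l lU; rewrite muln1 (leq_trans _ (deg l lU)) // size_nbrs.
  rewrite /blive count_filter; apply: sub_count => p /= /andP[/eqP -> /andP[_ ->]].
  by rewrite eqxx.
move=> l lU; apply/eqP; rewrite -leqn0 leqNgt -has_count -all_predC.
apply/allP => p; rewrite mem_filter /= => /andP[/andP[pU _] _].
by apply: contra pU => /eqP->.
Qed.

Lemma wf_unit U B l : wf (U, B) -> l \in lits N -> l \notin U ->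
  wf (l :: U, B) /\ mu (l :: U, B) + 4 * t1 <= mu (U, B).
Proof.
move=> W lL lU; have [/= /andP[uU uB] UL BL Bs deg] := W.
have W' : wf (l :: U, B).
  split=> //=.
  - by rewrite lU uU.
  - by move=> x; rewrite inE => /predU1P[->|/UL].
  - move=> x; rewrite inE negb_or => /andP[_ /deg]; apply: leq_trans.
    rewrite !size_nbrs; apply: sub_count => p /= /andP[->].
    by rewrite inE negb_or => /andP[].
split=> //.
(* A pair that dies has [l] as its first or second component; by [swap] both groups have the same
   size, at most [2 * t1]. *)
have loss : size (blive U B) <= size (blive (l :: U) B) + 4 * t1.
  rewrite /blive !size_filter.
  apply: leq_trans (@count_leq3 _ _ (fun p => (p.1 \notin l :: U) && (p.2 \notin l :: U))
    (fun p => (p.1 == l) && (p.2 \notin U)) (fun p => (p.2 == l) && (p.1 \notin U)) _ _) _.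
    move=> p /andP[h1 h2]; rewrite !inE !negb_or h1 h2 !andbT.
    by case: (p.1 == l); case: (p.2 == l).
  have sw := count_swap (fun p => (p.1 == l) && (p.2 \notin U)) uB Bs.
  have d := deg l lU; rewrite size_nbrs in d.
  rewrite -addnA leq_add2l -[4 * t1]/((2 + 2) * t1) mulnDl; apply: leq_add => //.
  by rewrite -sw in d; exact: d.
have sL : size U < N * 2.
  by rewrite -size_lits; apply: (@uniq_leq_size _ (l :: U)) => [|x]; rewrite /= ?lU // inE => /predU1P[->|/UL].
have := size_live W'; rewrite /mu /=.
have -> : N * 2 - size U = (N * 2 - (size U).+1).+1 by lia.
move: (N * 2 - _) => x; rewrite [8 * t1 * x.+1]mulnS -!mulnA.
move: loss; move: (t1 * x) (size (blive U B)) (size (blive (l :: U) B)) => y b b'; lia.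
Qed.

Lemma wf_units U B S : wf (U, B) -> uniq S -> {subset S <= lits N} ->
  (forall l, l \in S -> l \notin U) ->
  wf (S ++ U, B) /\ mu (S ++ U, B) + 4 * t1 * size S <= mu (U, B).
Proof.
move=> W; elim: S => [|l S IH] /=; first by rewrite muln0 addn0.
move=> /andP[lS uS] SL SU.
have SL' : {subset S <= lits N} by move=> x xS; apply: SL; rewrite inE xS orbT.
have SU' x : x \in S -> x \notin U by move=> xS; apply: SU; rewrite inE xS orbT.
have [W1 H1] := IH uS SL' SU'.
have [||W2 H2] := wf_unit (l := l) W1.
- by apply: SL; rewrite mem_head.
- by rewrite mem_cat negb_or lS SU // mem_head.
split=> //; apply: leq_trans H1; rewrite mulnS addnA leq_add2r; exact: H2.
Qed.

(** The new pairs are live and not yet present, so each lowers the potential by 1. The degree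
    condition is what the order of the branchings has to guarantee. *)
Lemma wf_pairs U B Q : wf (U, B) -> uniq Q ->
  (forall p, p \in Q -> [&& p \notin B, p.1 \in lits N, p.2 \in lits N, p.1 \notin U & p.2 \notin U]) ->
  (forall p, p \in Q -> swap p \in Q) ->
  (forall l, l \notin U -> size (nbrs U B l) + count (fun p => p.1 == l) Q <= 2 * t1) ->
  wf (U, Q ++ B) /\ mu (U, Q ++ B) + size Q <= mu (U, B).
Proof.
move=> W uQ QH Qs degQ; have [/= /andP[uU uB] UL BL Bs deg] := W.
have W' : wf (U, Q ++ B).
  split=> //=.
  - rewrite uU cat_uniq uQ uB andbT; apply/hasPn => p pB; apply/negP => /QH.
    by rewrite pB.
  - by move=> p; rewrite mem_cat => /orP[/QH/and5P[_ -> -> _ _]//|/BL].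
  - by move=> p; rewrite !mem_cat => /orP[/Qs->//|/Bs->]; rewrite orbT.
  - move=> l lU; apply: leq_trans (degQ l lU).
    rewrite !size_nbrs count_cat addnC leq_add2l.
    by apply: sub_count => p /= /andP[].
split=> //; have := size_live W'; rewrite /mu /=.
have -> : size (blive U (Q ++ B)) = size Q + size (blive U B).
  rewrite /blive filter_cat size_cat; congr (size _ + _).
  by apply/all_filterP/allP => p /QH/and5P[_ _ _ -> ->].
move: (N * 2 - _) => x; rewrite -!mulnA.
by move: (t1 * x) (size (blive U B)) (size Q) => y b q; lia.
Qed.

Lemma tlive_sub U B t : t \in tlive U B T ->
  [/\ t \in T, [&& t.1.1 \notin U, t.1.2 \notin U & t.2 \notin U]
    & [&& t.1 \notin B, (t.1.1, t.2) \notin B & (t.1.2, t.2) \notin B]].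
Proof. by rewrite mem_filter => /andP[/and5P[-> -> -> -> /andP[-> ->]] ->]. Qed.

(** Records the priority of the branchings: a later kind is used only when no earlier one applies,
    and its degree bounds depend on this. *)
Lemma head_cat_cases (X : eqType) (x : X) s1 s2 s3 d r : s1 ++ s2 ++ s3 = x :: r ->
  x = head d (s1 ++ s2 ++ s3) /\
  (x \in s1 \/ (s1 = [::] /\ x \in s2) \/ [/\ s1 = [::], s2 = [::] & x \in s3]).
Proof.
case: s1 => [|y s1]; last by case=> -> _ /=; split=> //; left; rewrite mem_head.
case: s2 => [|y s2]; last by case=> -> _ /=; split=> //; right; left; rewrite mem_head.
case: s3 => [|y s3] //; by case=> -> _ /=; split=> //; right; right; rewrite mem_head.
Qed.

Lemma map_filter_nil (X Y : Type) (f : X -> Y) (P : pred X) (s : seq X) :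
  [seq f x | x <- s & P x] = [::] -> ~~ has P s.
Proof. by move/(congr1 size)/eqP; rewrite size_map size_filter has_count -leqn0 -leqNgt. Qed.

Lemma branch1_nil U B l : branch1 t1 N U B = [::] -> l \in lits N -> l \notin U ->
  size (nbrs U B l) < t1.
Proof.
by move=> /map_filter_nil/hasPn H lL lU; have := H l lL; rewrite lU /= -ltnNge.
Qed.

Lemma branch2_nil U B a b : branch2 t1 N T U B = [::] -> a \in lits N -> b \in lits N ->
  size (thirds U B T (a, b)) < t1.
Proof.
move=> /map_filter_nil/hasPn H aL bL; rewrite ltnNge; apply: H.
by apply/allpairsP; exists (a, b).
Qed.

Lemma branch3_nil U B l : branch3 t2 N T U B = [::] -> l \in lits N ->
  size (links U B T l) < t2.
Proof. by move=> /map_filter_nil/hasPn H lL; rewrite ltnNge; apply: H. Qed.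

Lemma nbrs_notin U B l : wf (U, B) -> l \notin lits N -> nbrs U B l = [::].
Proof.
move=> [_ _ BL _ _] lL; apply: size0nil; rewrite size_nbrs; apply/eqP.
rewrite -leqn0 leqNgt -has_count -all_predC; apply/allP => p /BL /andP[pL _] /=.
by apply/nandP; left; apply: contra lL => /eqP <-.
Qed.

(** The degree that the link of [l] adds at [y] is the number of live triples on the pair, which is
    below [t1] once the second kind of branching is exhausted. *)
Lemma count_links U B l y : count (fun p => p.1 == y) (links U B T l) = size (thirds U B T (l, y)).
Proof.
rewrite count_map count_filter size_map size_filter; apply: eq_count => -[[a b] c] /=.
by rewrite xpair_eqE andbC.
Qed.

Lemma links_swap U B l p : wfT -> wf (U, B) -> p \in links U B T l -> swap p \in links U B T l.
Proof.
move=> [_ _ _ Ts] [_ _ _ Bs _] /mapP[[[a b] c]]; rewrite mem_filter /= => /andP[/eqP <-].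
case/tlive_sub => /= /Ts tT /and3P[aU bU cU] /and3P[abB acB bcB] ->.
apply/mapP; exists (a, c, b); rewrite // !mem_filter /= eqxx aU bU cU acB abB tT !andbT /=.
by apply: contra bcB => /Bs.
Qed.

(** In the first two kinds the second successor forces at least [t1] literals worth [4 * t1] each;
    in the third it adds at least [t2] pairs worth 1 each. Hence the minimum. *)
Lemma branches_wf s d : wfT -> wf s -> branches t1 t2 N T s != [::] ->
  let ab := head d (branches t1 t2 N T s) in
  [/\ wf ab.1, wf ab.2, mu ab.1 < mu s & mu ab.2 + minn (4 * t1 ^ 2) t2 <= mu s].
Proof.
move: s => [U B] WT W.
case E: (branches _ _ _ _ _) => [//|x r] _ /=; have [_] := head_cat_cases x E.
have [uT TL Ts1 Ts2] := WT; have [/= /andP[uU uB] UL BL Bs deg] := W.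
have uTL : uniq (tlive U B T) by rewrite filter_uniq.
case=> [|[[]|[]]] /=.
- case/mapP => l; rewrite mem_filter => /andP[/andP[lU ln] lL] -> /=.
  have [W1 H1] := wf_unit W lL lU.
  have [|y|y|W2 H2] := wf_units (S := nbrs U B l) W.
  + rewrite map_inj_in_uniq ?filter_uniq // => -[a b] [c e].
    by rewrite !mem_filter /= => /andP[/andP[/eqP-> _] _] /andP[/andP[/eqP-> _] _] ->.
  + by case/mapP => p; rewrite mem_filter => /andP[_ /BL/andP[_ ?]] ->.
  + by case/mapP => p; rewrite mem_filter => /andP[/andP[_ ?] _] ->.
  split=> //; first by apply: leq_trans H1; rewrite -addn1 leq_add2l muln_gt0.
  apply: leq_trans H2; rewrite leq_add2l (leq_trans (geq_minl _ _)) //.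
  by rewrite -mulnn mulnA leq_mul2l ln orbT.
- move=> E1 /mapP[[a b]]; rewrite mem_filter => /andP[thn _] -> /=.
  have [t0 t0p e0] : exists2 t0, t0 \in tlive U B T & t0.1 = (a, b).
    have /hasP[t0 t0t /eqP ?] : has (fun t => t.1 == (a, b)) (tlive U B T).
      by rewrite has_count (leq_trans t1_gt0) //; move: thn; rewrite size_map size_filter.
    by exists t0.
  have [t0T] := tlive_sub t0p; have := TL _ t0T; rewrite e0 /=.
  move=> /and3P[aL bL _] /and3P[aU bU _] /and3P[abB _ _].
  have [||||W1 H1] := wf_pairs (Q := undup [:: (a, b); (b, a)]) W.
  + exact: undup_uniq.
  + move=> p; rewrite mem_undup !inE => /orP[]/eqP-> /=; rewrite aL bL aU bU ?abB //=.
    by rewrite andbT; apply: contra abB => /Bs.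
  + by move=> p; rewrite !mem_undup !inE => /orP[]/eqP->; rewrite /swap /= eqxx ?orbT.
  (* A literal in range has at most [t1 - 1] live neighbours here and gains at most 2, which stays
     within [2 * t1] as [t1] is positive; one out of range has none to begin with. *)
  + move=> l lU; set k := count _ _.
    have k2 : k <= 2 by exact: leq_trans (count_size _ _) (size_undup _).
    have [lL|lL] := boolP (l \in lits N); last first.
      by rewrite nbrs_notin // add0n (leq_trans k2) // leq_pmulr.
    by have := branch1_nil E1 lL lU; clear -k2 t1_gt0; lia.
  have [|y|y|W2 H2] := wf_units (S := thirds U B T (a, b)) W.
  + rewrite map_inj_in_uniq ?filter_uniq // => -[[? ?] c] [[? ?] e].
    by rewrite !mem_filter /= => /andP[/eqP-> _] /andP[/eqP-> _] ->.
  + case/mapP => t; rewrite mem_filter => /andP[_ /tlive_sub[/TL /and3P[_ _ ?] _ _]] ->; exact.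
  + by case/mapP => t; rewrite mem_filter => /andP[_ /tlive_sub[_ /and3P[_ _ ?] _]] ->.
  split=> //.
    have : 0 < size (undup [:: (a, b); (b, a)]).
      by rewrite lt0n size_eq0; apply/negP => /eqP/(congr1 (fun s => (a, b) \in s)); rewrite mem_undup mem_head.
    by rewrite /swap /= in H1 *; lia.
  apply: leq_trans H2; rewrite leq_add2l (leq_trans (geq_minl _ _)) //.
  by rewrite -mulnn mulnA leq_mul2l thn orbT.
- move=> E1 E2 /mapP[l]; rewrite mem_filter => /andP[ln lL] -> /=.
  have lU : l \notin U.
    move: ln; rewrite size_map size_filter => ln.
    have /hasP[t0 /tlive_sub[_ /and3P[+ _ _] _] /eqP <-] // : has (fun t => t.1.1 == l) (tlive U B T).
      by rewrite has_count (leq_trans t2_gt0).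
  have [W1 H1] := wf_unit W lL lU.
  have [||||W2 H2] := wf_pairs (Q := links U B T l) W.
  + rewrite map_inj_in_uniq ?filter_uniq // => -[[? ?] c] [[? ?] e].
    by rewrite !mem_filter /= => /andP[/eqP-> _] /andP[/eqP-> _] [-> ->].
  + move=> p /mapP[t]; rewrite mem_filter => /andP[_ /tlive_sub[/TL /and3P[_ h4 h5] /and3P[_ h1 h2] /and3P[_ _ h3]]] -> /=.
    by rewrite h1 h2 h3 h4 h5.
  + by move=> p; apply: links_swap.
  + move=> y yU; rewrite count_links; have [yL|yL] := boolP (y \in lits N); last first.
      rewrite nbrs_notin //= (_ : thirds _ _ _ _ = [::]) //; apply: size0nil.
      rewrite size_map size_filter; apply/eqP; rewrite -leqn0 leqNgt -has_count -all_predC.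
      apply/allP => t /tlive_sub[/TL /and3P[_ tL _] _ _] /=; apply: contra yL => /eqP e.
      by rewrite e in tL.
    (* At most [t1] old pairs, as the first kind does not apply, and at most [t1] new ones, as the
       second does not: the origin of [2 * t1]. *)
    rewrite mul2n -addnn; apply: leq_add; first exact: ltnW (branch1_nil E1 yL yU).
    exact: ltnW (branch2_nil E2 lL yL).
  split=> //; first by apply: leq_trans H1; rewrite -addn1 leq_add2l muln_gt0.
  by apply: leq_trans H2; rewrite leq_add2l (leq_trans (geq_minr _ _)).
Qed.

End Sparsify.

(** * Satisfiability along the search tree *)

Definition lit_true (al : nat -> bool) (l : lit) : bool := al l.1 == l.2.

Definition triple_true (al : nat -> bool) (t : triple) : bool :=
  [|| lit_true al t.1.1, lit_true al t.1.2 | lit_true al t.2].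

Definition sat3 (F : seq triple) : Prop := exists al, all (triple_true al) F.

Definition models (T : seq triple) (s : state) (al : nat -> bool) : bool :=
  [&& all (lit_true al) s.1, all (fun p => lit_true al p.1 || lit_true al p.2) s.2
    & all (triple_true al) T].

Definition leaf_cnf (T : seq triple) (s : state) : seq triple :=
  [seq (l, l, l) | l <- s.1] ++ [seq (p.1, p.2, p.2) | p <- blive s.1 s.2]
  ++ tlive s.1 s.2 T.

Section BranchModels.
Local Arguments undup : simpl never.

(** The successors keep all clauses of the state, so their models are models of it; conversely,
    where the common part is false, every clause of the family makes its remainder true. *)
Lemma branches_models t1 t2 N T s d al : branches t1 t2 N T s != [::] ->
  models T s al = models T (head d (branches t1 t2 N T s)).1 al
               || models T (head d (branches t1 t2 N T s)).2 al.
Proof.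
move: s => [U B]; case E: (branches _ _ _ _ _) => [//|x r] _ /=.
have [_] := head_cat_cases x E => {E}.
have sub (P : pred triple) : all P T -> all P (tlive U B T).
  by move=> /allP H; apply/allP => t /tlive_sub[/H].
rewrite /models /=; case=> [|[[_]|[_ _]]] /mapP[y]; rewrite mem_filter => /andP[_ _] -> /=.
- rewrite all_cat; case HU: (all _ U); case HB: (all _ B) => /=; rewrite ?andbF ?andbT //=.
  case: (all _ T); rewrite ?andbF ?andbT //=; case ly: (lit_true al y) => //=.
  apply/esym/allP => z /mapP[p]; rewrite mem_filter => /andP[/andP[/eqP py _] pB] ->.
  by have := allP HB p pB; rewrite py ly.
- rewrite !all_cat; case HU: (all _ U); case HB: (all _ B) => /=; rewrite ?andbF ?andbT //=.
  case HT: (all _ T); rewrite ?andbF ?andbT //=.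
  rewrite (eq_all_r (mem_undup _)) /= andbT orbC [lit_true al y.2 || _]orbC andbb.
  case ly: (lit_true al y.1 || lit_true al y.2); first by rewrite orbT.
  rewrite orbF; apply/esym/allP => z /mapP[t]; rewrite mem_filter => /andP[/eqP ty tT] ->.
  by have := allP (sub _ HT) t tT; rewrite /triple_true ty orbA ly.
- rewrite !all_cat; case HU: (all _ U); case HB: (all _ B) => /=; rewrite ?andbF ?andbT //=.
  case HT: (all _ T); rewrite ?andbF ?andbT //=; case ly: (lit_true al y) => //=.
  apply/esym/allP => z /mapP[t]; rewrite mem_filter => /andP[/eqP ty tT] -> /=.
  by have := allP (sub _ HT) t tT; rewrite /triple_true ty ly.
Qed.

End BranchModels.

(** A pair that is not live contains a forced literal, and a triple that is not live contains a
    forced literal or a pair of the state; dropping them loses no constraint. *)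
Lemma leaf_models T s al : all (triple_true al) (leaf_cnf T s) = models T s al.
Proof.
move: s => [U B]; rewrite /leaf_cnf /models !all_cat !all_map /=.
rewrite (@eq_all _ _ (lit_true al)) => [|l]; last by rewrite /= /triple_true /= !orbb.
case HU: (all _ U) => //=.
have uT l : l \in U -> lit_true al l by move/(allP HU).
apply/andP/andP => -[/allP HB /allP HT].
  have HB' p : p \in B -> lit_true al p.1 || lit_true al p.2.
    move=> pB; case: (boolP (p.1 \in U)) => [/uT->//|p1].
    case: (boolP (p.2 \in U)) => [/uT->|p2]; first by rewrite orbT.
    by have := HB p; rewrite mem_filter p1 p2 pB /= /triple_true /= orbb; apply.
  split; first by apply/allP.
  apply/allP => t tT; rewrite /triple_true.
  case: (boolP (t \in tlive U B T)) => [/HT //|]; rewrite mem_filter tT andbT.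
  rewrite !negb_and !negbK.
  case/or4P => [/uT->//|/uT->|/uT->|]; rewrite ?orbT //.
  by case/or3P => /HB' /= /orP[]->; rewrite ?orbT.
split; first by apply/allP => p; rewrite mem_filter /triple_true /= orbb => /andP[_ /HB].
by apply/allP => t /tlive_sub[/HT].
Qed.

(** * Bounded occurrence at the leaves *)

Section Leaf.
Variables (t1 t2 N : nat) (T : seq triple) (s : state).
Hypotheses (WT : wfT N T) (W : wf t1 N s) (leaf : branches t1 t2 N T s = [::]).
Let D := (t1 + t2).+1.

Lemma leaf_lits t : t \in leaf_cnf T s -> [&& t.1.1.1 < N, t.1.2.1 < N & t.2.1 < N].
Proof using WT W.
have [uT TL _ _] := WT; have [_ UL BL _ _] := W; rewrite -!mem_lits.
rewrite !mem_cat => /or3P[/mapP[l /UL lL ->] /=|/mapP[p]|].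
- by rewrite lL.
- by rewrite mem_filter => /andP[_ /BL /andP[p1 p2]] -> /=; rewrite p1 p2.
- by case/tlive_sub => /TL.
Qed.

(** At most one unit clause, [t1] live pairs and [t2] live triples begin with [l], since the first
    and third kinds of branching no longer apply; this gives [D]. *)
Lemma leaf_count_slot1 l : count (fun t => t.1.1 == l) (leaf_cnf T s) <= D.
Proof using WT W leaf.
have [uT TL _ _] := WT; have [/andP[uU uB] UL BL Bs _] := W.
have [lN|lN] := boolP (l \in lits N); last first.
  rewrite [X in X <= _](_ : _ = 0) //; apply/eqP; rewrite -leqn0 leqNgt -has_count -all_predC.
  by apply/allP => t /leaf_lits /and3P[tN _ _] /=; apply: contra lN => /eqP <-; rewrite mem_lits.
move: leaf; rewrite /branches => /(congr1 size); rewrite !size_cat => /eqP.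
rewrite !addn_eq0 !size_eq0 => /and3P[/eqP E1 /eqP E2 /eqP E3].
rewrite !count_cat !count_map /D -add1n leq_add //.
  by rewrite (@eq_count _ _ (pred1 l)) // count_uniq_mem // leq_b1.
rewrite leq_add //.
  have [lU|lU] := boolP (l \in s.1).
    rewrite [X in X <= _](_ : _ = 0) //; apply/eqP; rewrite -leqn0 leqNgt -has_count -all_predC.
    apply/allP => p; rewrite mem_filter /= => /andP[/andP[pU _] _].
    by apply: contra pU => /eqP->.
  apply: leq_trans (ltnW (branch1_nil E1 lN lU)); rewrite size_nbrs count_filter.
  by apply: sub_count => p /= /andP[-> /andP[_ ->]].
apply: leq_trans (ltnW (branch3_nil E3 lN)).
by rewrite size_map size_filter.
Qed.

Lemma tlive_swap12 a b c : (a, b, c) \in tlive s.1 s.2 T -> (b, a, c) \in tlive s.1 s.2 T.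
Proof using WT W.
have [_ _ Ts _] := WT; have [_ _ _ Bs _] := W.
case/tlive_sub => /= /Ts tT /and3P[aU bU cU] /and3P[abB acB bcB].
rewrite mem_filter /= aU bU cU acB bcB tT !andbT.
by apply: contra abB => /Bs.
Qed.

Lemma tlive_swap23 a b c : (a, b, c) \in tlive s.1 s.2 T -> (a, c, b) \in tlive s.1 s.2 T.
Proof using WT W.
have [_ _ _ Ts] := WT; have [_ _ _ Bs _] := W.
case/tlive_sub => /= /Ts tT /and3P[aU bU cU] /and3P[abB acB bcB].
rewrite mem_filter /= aU bU cU acB abB tT !andbT.
by apply: contra bcB => /Bs.
Qed.

(** Exchanging the first two components permutes the live pairs and the live triples, so the counts
    are those of the first slot. *)
Lemma leaf_count_slot2 l : count (fun t => t.1.2 == l) (leaf_cnf T s) <= D.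
Proof using WT W leaf.
apply: leq_trans (leaf_count_slot1 l); rewrite !count_cat !count_map.
have [uT _ _ _] := WT; have [/andP[uU uB] _ _ Bs _] := W.
rewrite leq_add2l; apply: eq_leq; congr (_ + _).
  apply: (@count_swap _ (fun p => p.1 == l)); first by rewrite filter_uniq.
  by move=> p; rewrite !mem_filter /= => /andP[/andP[-> ->] /Bs].
apply: (@count_involution _ (fun t => (t.1.2, t.1.1, t.2)) (fun t => t.1.1 == l)).
- by case=> -[].
- by rewrite filter_uniq.
- by move=> [[a b] c]; apply: tlive_swap12.
Qed.

Lemma leaf_count_slot3 l : count (fun t => t.2 == l) (leaf_cnf T s) <= D.
Proof using WT W leaf.
apply: leq_trans (leaf_count_slot2 l); rewrite !count_cat !count_map.
have [uT _ _ _] := WT.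
rewrite !leq_add2l; apply: eq_leq.
apply: (@count_involution _ (fun t => (t.1.1, t.2, t.1.2)) (fun t => t.1.2 == l)).
- by case=> -[].
- by rewrite filter_uniq.
- by move=> [[a b] c]; apply: tlive_swap23.
Qed.

Lemma count_var (f : triple -> lit) (F : seq triple) v :
  (forall l, count (fun t => f t == l) F <= D) ->
  count (fun t => (f t).1 == v) F <= D * 2.
Proof.
move=> H; rewrite muln2 -addnn; apply: leq_trans (leq_add (H (v, true)) (H (v, false))).
rewrite -count_predUI; apply: leq_trans (leq_addr _ _); apply: sub_count => t /=.
by case: (f t) => w [] /= /eqP->; rewrite eqxx ?orbT.
Qed.

Lemma size_leaf : size (leaf_cnf T s) <= D * 2 * N.
Proof using WT W leaf.
rewrite (@size_sum_count _ _ (fun t => t.1.1) (lits N)); last 2 first.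
- exact: uniq_lits.
- by move=> t /leaf_lits /and3P[tN _ _]; rewrite mem_lits.
apply: leq_trans (_ : \sum_(l <- lits N) D <= _).
  by apply: leq_sum => l _; apply: leaf_count_slot1.
by rewrite big_const_seq count_predT iter_addn_0 size_lits mulnA mulnAC.
Qed.

End Leaf.

(** * Placing the clauses of a sparse formula *)

(** The square root of [N] rounded up, as the number of [k] with square below [N]. *)
Definition side (N : nat) : nat := size [seq k <- iota 0 N | k * k < N].

Lemma side_spec N : N <= side N * side N /\ (0 < side N -> (side N).-1 * (side N).-1 < N).
Proof.
have ex : exists k, N <= k * k by exists N; case: N => // n; rewrite leq_pmulr.
case: (ex_minnP ex) => K HK minK.
have KN : K <= N by apply: minK; case: (N) => // n; rewrite leq_pmulr.
have -> : side N = K.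
  rewrite /side size_filter (@eq_count _ _ (fun k => k < K)); last first.
    move=> k; apply/idP/idP => [kN|kK]; last by rewrite ltnNge; apply/negP => /minK; rewrite leqNgt kK.
    rewrite ltnNge; apply/negP => Kk; move: kN; rewrite ltnNge.
    by rewrite (leq_trans HK) // leq_mul.
  rewrite -(subnKC KN) iotaD count_cat add0n.
  rewrite (@eq_in_count _ _ predT) => [|k]; last by rewrite mem_iota => /andP[_ ->].
  rewrite count_predT size_iota (@eq_in_count _ _ pred0) ?count_pred0 ?addn0 // => k.
  by rewrite mem_iota => /andP[Kk _]; rewrite /= ltnNge Kk.
split=> // K0; rewrite ltnNge; apply/negP => /minK.
by case: (K) K0 => // k _ /=; rewrite ltnn.
Qed.

Lemma side_sq N : side N * side N <= 4 * N.
Proof.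
have [_] := side_spec N; case: (side N) => // -[|k] /(_ isT) /= H; first lia.
by move: H; nia.
Qed.

(** The grid in row-major order, read from a table: no division has to be programmed. *)
Definition coord (K v : nat) : nat * nat :=
  nth (0, 0) [seq (h, b) | h <- iota 0 K, b <- iota 0 K] v.

Lemma coord_lt K v : v < K * K -> (coord K v).1 < K /\ (coord K v).2 < K.
Proof.
move=> vK.
have /allpairsP[[h b] [+ + ->]] : coord K v \in [seq (h, b) | h <- iota 0 K, b <- iota 0 K].
  by apply: mem_nth; rewrite size_allpairs size_iota.
by rewrite !mem_iota.
Qed.

Lemma coord_inj K v w : v < K * K -> w < K * K -> coord K v = coord K w -> v = w.
Proof.
move=> vK wK /eqP; rewrite nth_uniq ?size_allpairs ?size_iota //; first by move/eqP.
by apply: allpairs_uniq; rewrite ?iota_uniq // => -[? ?] [? ?] _ _ [-> ->].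
Qed.

Definition cb (K : nat) (l : lit) : nat := (coord K l.1).2.

(** Clauses that would claim a common cell if they shared a row. Only equal positions are compared,
    because each position has its own block of columns. *)
Definition conflict (K : nat) (t u : triple) : bool :=
  [|| cb K t.1.1 == cb K u.1.1, cb K t.1.2 == cb K u.1.2 | cb K t.2 == cb K u.2].

Definition free_row (K R : nat) (t : triple) (acc : seq (nat * triple)) : nat :=
  head 0 [seq r <- iota 0 R | r \notin [seq e.1 | e <- [seq e <- acc | conflict K e.2 t]]].

Definition place (K R : nat) (F : seq triple) : seq (nat * triple) :=
  foldr (fun t acc => (free_row K R t acc, t) :: acc) [::] F.

Lemma place_snd K R F : [seq e.2 | e <- place K R F] = F.
Proof. by elim: F => //= t F ->. Qed.

Lemma size_place K R F : size (place K R F) = size F.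
Proof. by rewrite -{2}(place_snd K R F) size_map. Qed.

(** Pigeonhole: fewer than [R] conflicting clauses cannot occupy all [R] rows, so the default 0 of
    [head] is not reached. *)
Lemma free_rowP K R t acc : count (fun e => conflict K e.2 t) acc < R ->
  free_row K R t acc < R /\
  (forall e, e \in acc -> e.1 = free_row K R t acc -> ~~ conflict K e.2 t).
Proof.
move=> H; set s := [seq r <- iota 0 R | r \notin [seq e.1 | e <- [seq e <- acc | conflict K e.2 t]]].
have : free_row K R t acc \in s.
  rewrite /free_row -/s; case E: s => [|r s']; last by rewrite mem_head.
  have : size (iota 0 R) <= size [seq e.1 | e <- [seq e <- acc | conflict K e.2 t]].
    apply: uniq_leq_size; first exact: iota_uniq.
    move=> r rR; apply/negPn/negP => nr.
    have : r \in s by rewrite mem_filter nr.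
    by rewrite E.
  by rewrite size_iota size_map size_filter leqNgt H.
rewrite mem_filter mem_iota add0n => /andP[nr /andP[_ rR]]; split=> // e ea er.
apply: contra nr => c; apply/mapP; exists e => //.
by rewrite mem_filter c.
Qed.

Definition compatible (K : nat) (e e' : nat * triple) : bool :=
  (e.1 == e'.1) ==> ~~ conflict K e.2 e'.2.

Lemma conflict_sym K t u : conflict K t u = conflict K u t.
Proof. by rewrite /conflict ![cb K t.1.1 == _]eq_sym ![cb K t.1.2 == _]eq_sym ![cb K t.2 == _]eq_sym. Qed.

(** Greedy colouring of the conflict graph, with the rows as colours. *)
Lemma placeP K R F : (forall t, t \in F -> count (fun u => conflict K u t) F < R) ->
  all (fun e => e.1 < R) (place K R F) && pairwise (compatible K) (place K R F).
Proof.
elim: F => // t F IH H /=.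
have /andP[-> ->] : all (fun e => e.1 < R) (place K R F) && pairwise (compatible K) (place K R F).
  apply: IH => u uF; apply: leq_ltn_trans (H u _); first by rewrite /= leq_addl.
  by rewrite inE uF orbT.
have [|-> fr] := @free_rowP K R t (place K R F).
  have /= := H t (mem_head _ _); rewrite -{1}(place_snd K R F) count_map; apply: leq_ltn_trans.
  by rewrite leq_addl.
rewrite !andbT; apply/allP => e ep; apply/implyP => /eqP /= E.
by rewrite conflict_sym; apply: fr.
Qed.

(** In one position a conflict fixes the column coordinate, which leaves at most [K] variables, one
    per home row, with at most [D] occurrences each; there are three positions. *)
Lemma count_conflict N K D F t : N <= K * K ->
  (forall u, u \in F -> [&& u.1.1.1 < N, u.1.2.1 < N & u.2.1 < N]) ->
  (forall v, count (fun u => u.1.1.1 == v) F <= D) ->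
  (forall v, count (fun u => u.1.2.1 == v) F <= D) ->
  (forall v, count (fun u => u.2.1 == v) F <= D) ->
  count (fun u => conflict K u t) F <= 3 * (K * D).
Proof.
move=> NK FN D1 D2 D3.
have slot (f : triple -> lit) (b : nat) : (forall u, u \in F -> (f u).1 < N) ->
    (forall v, count (fun u => (f u).1 == v) F <= D) ->
    count (fun u => cb K (f u) == b) F <= K * D.
  move=> fN H; rewrite -size_filter.
  rewrite (@size_sum_count _ _ (fun u => (coord K (f u).1).1) (iota 0 K)); last 2 first.
  - exact: iota_uniq.
  - move=> u; rewrite mem_filter mem_iota => /andP[_ /fN uN].
    by have [] := coord_lt (leq_trans uN NK).
  apply: leq_trans (_ : \sum_(h <- iota 0 K) D <= _); last first.
    by rewrite big_const_seq count_predT iter_addn_0 size_iota mulnC.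
  apply: leq_sum => h _; rewrite count_filter.
  (* If some clause has a variable with home [(h, b)], injectivity of [coord] makes it the same
     variable in all such clauses. *)
  have [/hasP[u uF /= /andP[/eqP E1 /eqP E2]]|] := boolP (has (fun u => ((coord K (f u).1).1 == h) && (cb K (f u) == b)) F); last first.
    by rewrite has_count -leqNgt leqn0 => /eqP E; rewrite [X in X <= _]E.
  apply: leq_trans (H (f u).1); rewrite (@eq_in_count _ _ (fun w => ((f w).1 == (f u).1) &&
     (((coord K (f w).1).1 == h) && (cb K (f w) == b)))).
    by apply: sub_count => w /andP[].
  move=> w wF /=; apply/esym; apply: andb_idl => /andP[/eqP w1 /eqP w2].
  apply/eqP; apply: (@coord_inj K); try by apply: leq_trans NK; apply: fN.
  by move: w1 w2 E1 E2; rewrite /cb; case: (coord _ _) (coord _ _) => [? ?] [? ?] /= -> -> -> ->.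
apply: leq_trans (_ : count (fun u => cb K u.1.1 == cb K t.1.1) F +
    count (fun u => cb K u.1.2 == cb K t.1.2) F + count (fun u => cb K u.2 == cb K t.2) F <= _).
  exact: count_leq3.
rewrite !mulSn addn0 addnA !leq_add //.
- by apply: (slot (fun u => u.1.1)) => // u /FN/and3P[].
- by apply: (slot (fun u => u.1.2)) => // u /FN/and3P[].
- by apply: (slot (fun u => u.2)) => // u /FN/and3P[].
Qed.

(** * The clique instance *)

Definition cset (n : nat) (s : seq nat) : {set 'I_n} := [set x : 'I_n | val x \in s].

Lemma cset2 n (x y : 'I_n) : [set x; y] = cset n [:: val x; val y].
Proof. by apply/setP => z; rewrite !inE !val_eqE. Qed.

Lemma cset2C n u v : cset n [:: u; v] = cset n [:: v; u].
Proof. by apply/setP => z; rewrite !inE orbC. Qed.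

Lemma has_spanning_starP n (E : {set {set 'I_n}}) (s : seq nat) :
  all (fun x => x < n) s ->
  has_spanning_star E (cset n s) <->
  (exists2 v, v \in s & forall u, u \in s -> u != v -> cset n [:: v; u] \in E).
Proof.
move=> /allP sn; split=> [[v vs H]|[v vs H]].
  exists (val v); first by rewrite inE in vs.
  move=> u us uv; have un := sn u us.
  by have := H (Ordinal un); rewrite inE cset2; apply.
have vn := sn v vs; exists (Ordinal vn); first by rewrite inE.
by move=> u; rewrite inE cset2 => us uv; apply: H.
Qed.

(* If the vertices of [S] are already joined to each other, a community
   [u :: S] is a disjunction: some edge from [u] to [S] is present. *)
Lemma has_spanning_star_or n (E : {set {set 'I_n}}) u (S : seq nat) :
  all (fun x => x < n) (u :: S) -> S != [::] -> u \notin S ->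
  (forall x y, x \in S -> y \in S -> x != y -> cset n [:: x; y] \in E) ->
  has_spanning_star E (cset n (u :: S)) <-> exists2 x, x \in S & cset n [:: u; x] \in E.
Proof.
move=> un S0 uS SE; rewrite has_spanning_starP //; split=> [[v vs H]|[x xS ux]].
  move: vs; rewrite inE => /predU1P[vu|vS]; last first.
    exists v => //; rewrite cset2C; apply: H; first by rewrite mem_head.
    by apply: contraNneq uS => ->.
  case: S S0 {SE un} uS H => // x S _ uS H; exists x; first exact: mem_head.
  rewrite -vu; apply: H; first by rewrite !inE eqxx orbT.
  by move: uS; rewrite inE negb_or vu eq_sym => /andP[].
exists x; first by rewrite inE xS orbT.
move=> y; rewrite inE => /predU1P[->|yS] yx; first by rewrite cset2C.
by apply: SE => //; rewrite eq_sym.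
Qed.

Lemma cset2_inj n u v u' v' : u < v < n -> u' < v' < n ->
  cset n [:: u; v] = cset n [:: u'; v'] -> (u, v) = (u', v').
Proof.
move=> /andP[uv vn] /andP[uv' vn'] /setP E.
have un := ltn_trans uv vn; have un' := ltn_trans uv' vn'.
have := E (Ordinal un); have := E (Ordinal vn).
have := E (Ordinal un'); have := E (Ordinal vn').
rewrite !inE /= !eqxx ?orbT /=.
by move=> h1 h2 h3 h4; congr pair; lia.
Qed.

Section Gadget.
Variables (K R : nat).

(** Vertices in order: [K] home rows, [R] clause rows, then three blocks of [K] column pairs, one
    block per clause position. *)
Definition nv : nat := K + R + (3 * K) * 2.

Definition col (s b : nat) (tau : bool) : nat :=
  if tau then (K + R + (s * K + b) * 2).+1 else K + R + (s * K + b) * 2.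

Definition slots (t : triple) : seq (nat * lit) := [:: (0, t.1.1); (1, t.1.2); (2, t.2)].

Definition home_cells : seq (nat * (nat * nat)) :=
  [seq (h, q) | h <- iota 0 K, q <- [seq (s, b) | s <- iota 0 3, b <- iota 0 K]].

Definition clause_cells (rows : seq (nat * triple)) : seq (nat * (nat * nat)) :=
  [seq (K + e.1, (x.1, cb K x.2)) | e <- rows, x <- slots e.2].

Definition cells rows := home_cells ++ clause_cells rows.

Definition cell_ors rows : seq (nat * seq nat) :=
  [seq (c.1, [:: col c.2.1 c.2.2 true; col c.2.1 c.2.2 false]) | c <- cells rows].

(** Given one edge per cell, the disjunctions for both values of [tau] say that the cells of a home
    row at coordinate [b] in block 0 and in block [s] agree. *)
Definition home_ors : seq (nat * seq nat) :=
  [seq (c.1, [:: col 0 c.2.2 tau; col c.2.1 c.2.2 (~~ tau)])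
     | c <- home_cells, tau <- [:: true; false]].

(** Given one edge per cell, the disjunctions for both values of [tau] say that the clause cell and
    the home cell in this column pair carry opposite values. *)
Definition link_ors (rows : seq (nat * triple)) : seq (nat * seq nat) :=
  [seq (col x.1.1 (cb K x.1.2) x.2, [:: K + e.1; (coord K x.1.2.1).1])
     | e <- rows, x <- [seq (y, tau) | y <- slots e.2, tau <- [:: true; false]]].

Definition clause_ors (rows : seq (nat * triple)) : seq (nat * seq nat) :=
  [seq (K + e.1, [seq col x.1 (cb K x.2) x.2.2 | x <- slots e.2]) | e <- rows].

Definition forced : seq (nat * nat) :=
  [seq p <- [seq (u, v) | u <- iota 0 nv, v <- iota 0 nv]
     | (p.1 < p.2) && ((p.1 < K + R) == (p.2 < K + R))].

Definition ors rows := cell_ors rows ++ home_ors ++ link_ors rows ++ clause_ors rows.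

Definition constraints rows : seq (nat * seq nat) :=
  [seq (p.1, [:: p.2]) | p <- forced] ++ ors rows.

Definition budget rows : nat := size forced + size (cells rows).

Lemma mem_forced u v :
  ((u, v) \in forced) = [&& u < v, v < nv & (u < K + R) == (v < K + R)].
Proof.
rewrite mem_filter /=; case: ltnP => //= uv; rewrite andbC; congr (_ && _).
apply/allpairsP/idP => [[[x y] /= [_ + [_ ->]]]|vn]; first by rewrite mem_iota.
by exists (u, v); rewrite !mem_iota /= (ltn_trans uv).
Qed.

Lemma uniq_forced : uniq forced.
Proof.
by rewrite filter_uniq //; apply: allpairs_uniq; rewrite ?iota_uniq // => -[? ?] [? ?] _ _ [-> ->].
Qed.

Lemma col_range s b tau : s < 3 -> b < K -> K + R <= col s b tau < nv.
Proof.
rewrite /col /nv => s3 bK.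
have sb : s * K + b < 3 * K by case: s s3 => [|[|[|]]] //; lia.
by case: tau; lia.
Qed.

Lemma col_inj s b tau s' b' tau' : b < K -> b' < K ->
  col s b tau = col s' b' tau' -> [/\ s = s', b = b' & tau = tau'].
Proof.
rewrite /col => bK bK' E.
have [E1 ->] : s * K + b = s' * K + b' /\ tau = tau' by case: tau tau' E => [] []; lia.
have /(congr1 (fun x => (x %/ K, x %% K))) := E1.
rewrite !divnMDl ?(leq_trans _ bK) // !modnMDl !divn_small // !modn_small // !addn0.
by case.
Qed.

Lemma mem_home h s b : ((h, (s, b)) \in home_cells) = [&& h < K, s < 3 & b < K].
Proof.
apply/allpairsP/and3P => [|[hK s3 bK]].
  case=> -[h' q] [hK /allpairsP[[s' b'] [s3 bK ->]] [-> -> ->]].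
  by move: hK s3 bK; rewrite !mem_iota.
exists (h, (s, b)); split=> //; first by rewrite mem_iota.
by apply/allpairsP; exists (s, b); split=> //; rewrite mem_iota.
Qed.

Lemma uniq_home : uniq home_cells.
Proof.
apply: allpairs_uniq; first exact: iota_uniq.
  by apply: allpairs_uniq; rewrite ?iota_uniq // => -[? ?] [? ?] _ _ [-> ->].
by move=> [? ?] [? ?] _ _ [-> ->].
Qed.

Lemma size_home : size home_cells = 3 * K * K.
Proof. by rewrite !size_allpairs !size_iota mulnC. Qed.

Lemma size_clause_cells rows : size (clause_cells rows) = 3 * size rows.
Proof. by rewrite size_allpairs_dep; elim: rows => //= e rows ->; rewrite mulnS. Qed.

Section Placed.
Variables (N : nat) (rows : seq (nat * triple)).
Hypothesis NK : N <= K * K.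
Hypothesis rowsR : all (fun e => e.1 < R) rows.
Hypothesis rowsC : pairwise (compatible K) rows.
Hypothesis rowsN : forall e, e \in rows -> [&& e.2.1.1.1 < N, e.2.1.2.1 < N & e.2.2.1 < N].

Lemma slot_lt e x : e \in rows -> x \in slots e.2 ->
  [/\ x.1 < 3, x.2.1 < N, (coord K x.2.1).1 < K & cb K x.2 < K].
Proof using NK rowsN.
move=> /rowsN /and3P[h1 h2 h3] xs.
have [x3 xN] : x.1 < 3 /\ x.2.1 < N by move: xs; rewrite !inE => /or3P[]/eqP->.
by have [] := coord_lt (leq_trans xN NK).
Qed.

Lemma cells_lt c : c \in cells rows -> [/\ c.1 < K + R, c.2.1 < 3 & c.2.2 < K].
Proof using NK rowsR rowsN.
rewrite mem_cat; case: c => r [s b]; rewrite mem_home => /orP[/and3P[rK -> ->]|].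
  by split=> //; rewrite ltn_addr.
case/allpairsPdep => e [x [er xs [-> -> ->]]] /=; have [? _ _ ?] := slot_lt er xs.
by split=> //; rewrite ltn_add2l (allP rowsR).
Qed.

(** The budget counts cells with multiplicity, so they must be distinct. Compatibility separates
    clauses sharing a row, and the blocks separate the literals of one clause. *)
Lemma uniq_cells : uniq (cells rows).
Proof using NK rowsR rowsN rowsC.
rewrite cat_uniq uniq_home andTb; apply/andP; split.
  apply/hasPn => -[r [s b]] /allpairsPdep[e [x [_ _ [-> _ _]]]].
  by rewrite mem_home ltnNge leq_addr.
elim: rows rowsC => // e s IH; rewrite pairwise_cons => /andP[ce cs].
rewrite -[clause_cells _]/([seq (K + e.1, (x.1, cb K x.2)) | x <- slots e.2] ++ clause_cells s).
rewrite cat_uniq IH // andbT; apply/andP; split.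
  by rewrite /= !inE !xpair_eqE /= !andbF.
apply/hasPn => c /allpairsPdep[e' [x [e's xs ->]]]; rewrite !inE !xpair_eqE /= eqn_add2l.
have := allP ce e' e's; rewrite /compatible eq_sym; case: eqP => //= _.
rewrite /conflict !negb_or => /and3P[n1 n2 n3].
by move: xs; rewrite !inE => /or3P[]/eqP-> /=; rewrite ?[cb K e'.2.1.1 == _]eq_sym
  ?[cb K e'.2.1.2 == _]eq_sym ?[cb K e'.2.2 == _]eq_sym ?(negPf n1) ?(negPf n2) ?(negPf n3).
Qed.

(** Each disjunction leads from one side to a nonempty set on the other, which the forced edges turn
    into a clique, as [has_spanning_star_or] requires. *)
Lemma orsP p : p \in ors rows ->
  [/\ p.1 < nv, p.2 != [::] & forall x, x \in p.2 -> (x < nv) && ((x < K + R) != (p.1 < K + R))].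
Proof using NK rowsR rowsN.
have KRnv : K + R <= nv by rewrite leq_addr.
have colP s b tau : s < 3 -> b < K -> (col s b tau < nv) /\ (col s b tau < K + R) = false.
  by move=> s3 bK; have /andP[h ->] := col_range tau s3 bK; rewrite ltnNge h.
rewrite !mem_cat => /or4P[].
- case/mapP => c /cells_lt[c1 c2 c3] -> /=; split=> //; first exact: leq_trans KRnv.
  move=> x; rewrite !inE => /orP[]/eqP->; rewrite c1.
    by have [-> ->] := colP _ _ true c2 c3.
  by have [-> ->] := colP _ _ false c2 c3.
- case/allpairsP => -[[h [s b]] tau] /= [+ _ ->] /=; rewrite mem_home => /and3P[hK s3 bK].
  have hKR : h < K + R by rewrite ltn_addr.
  split=> //; first exact: leq_trans KRnv.
  move=> x; rewrite !inE hKR => /orP[]/eqP->.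
    by have [-> ->] := colP 0 b tau isT bK.
  by have [-> ->] := colP s b (~~ tau) s3 bK.
- case/allpairsPdep => e [x [er /allpairsP[[y tau] /= [ys _ ->]] ->]] /=.
  have [y3 _ hK bK] := slot_lt er ys; have [h1 h2] := colP _ _ tau y3 bK; rewrite h1 h2.
  split=> // z; rewrite !inE => /orP[]/eqP->.
    have : K + e.1 < K + R by rewrite ltn_add2l (allP rowsR).
    by move=> h; rewrite h (leq_trans h).
  have h : (coord K y.2.1).1 < K + R by rewrite ltn_addr.
  by rewrite h (leq_trans h).
- case/mapP => e er -> /=; have h : K + e.1 < K + R by rewrite ltn_add2l (allP rowsR).
  rewrite h (leq_trans h) //; split=> // z zs.
  have {zs} /mapP[x xs ->] : z \in [seq col x.1 (cb K x.2) x.2.2 | x <- slots e.2] by [].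
  have [x3 _ _ bK] := slot_lt er xs.
  by have [-> ->] := colP _ _ x.2.2 x3 bK.
Qed.

End Placed.
End Gadget.

(** * Correctness of the gadget *)

Section GadgetCorrect.
Variables (K R N : nat) (rows : seq (nat * triple)).
Hypothesis NK : N <= K * K.
Hypothesis rowsR : all (fun e => e.1 < R) rows.
Hypothesis rowsC : pairwise (compatible K) rows.
Hypothesis rowsN : forall e, e \in rows -> [&& e.2.1.1.1 < N, e.2.1.2.1 < N & e.2.2.1 < N].
Local Notation n := (nv K R).
Local Notation edge u v := (cset n [:: u; v]).

Lemma constraintsP (E : {set {set 'I_n}}) :
  (forall p, p \in constraints K R rows -> has_spanning_star E (cset n (p.1 :: p.2))) <->
  (forall p, p \in forced K R -> edge p.1 p.2 \in E) /\
  (forall p, p \in ors K R rows -> exists2 x, x \in p.2 & edge p.1 x \in E).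
Proof using NK rowsR rowsN.
have fE p : p \in forced K R ->
    has_spanning_star E (cset n [:: p.1; p.2]) <-> edge p.1 p.2 \in E.
  case: p => u v; rewrite mem_forced => /and3P[uv vn _] /=.
  rewrite has_spanning_star_or //=.
  - by split=> [[x]|]; [rewrite inE => /eqP-> | exists v; rewrite ?inE].
  - by rewrite vn (ltn_trans uv).
  - by rewrite inE ltn_eqF.
  - by move=> x y; rewrite !inE => /eqP-> /eqP->; rewrite eqxx.
have oE p : (forall p, p \in forced K R -> edge p.1 p.2 \in E) -> p \in ors K R rows ->
    has_spanning_star E (cset n (p.1 :: p.2)) <-> exists2 x, x \in p.2 & edge p.1 x \in E.
  move=> HF /(orsP NK rowsR rowsN)[p1 p2 pS]; apply: has_spanning_star_or => //.
  - by rewrite /= p1; apply/allP => x /pS/andP[].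
  - by apply/negP => /pS; rewrite eqxx andbF.
  - move=> x y xS yS xy.
    have /andP[xn xs] := pS x xS; have /andP[yn ys] := pS y yS.
    have sd : (x < K + R) == (y < K + R) by move: xs ys; do 3!case: (_ < K + R).
    have [lt|gt|e] := ltngtP x y; last by rewrite e eqxx in xy.
      by apply: (HF (x, y)); rewrite mem_forced lt yn.
    by rewrite cset2C; apply: (HF (y, x)); rewrite mem_forced gt xn eq_sym.
split=> [H|[HF HO] p].
  have HF p : p \in forced K R -> edge p.1 p.2 \in E.
    move=> pf; apply/(fE p pf)/(H (p.1, [:: p.2])).
    by rewrite mem_cat; apply/orP; left; apply/mapP; exists p.
  split=> // p po; apply/(oE p HF po)/H; by rewrite mem_cat po orbT.
rewrite mem_cat => /orP[/mapP[q qf ->]|po]; first exact/(fE q qf)/HF.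
exact/(oE p HF po)/HO.
Qed.

Lemma edges_leq_card (E : {set {set 'I_n}}) (s : seq (nat * nat)) :
  uniq s -> (forall p, p \in s -> p.1 < p.2 < n) ->
  (forall p, p \in s -> edge p.1 p.2 \in E) -> size s <= #|E|.
Proof.
move=> us sn sE; rewrite -(size_map (fun p => edge p.1 p.2)).
have /card_uniqP <- : uniq [seq edge p.1 p.2 | p <- s].
  rewrite map_inj_in_uniq // => -[a b] [c d] /sn h /sn h' /=.
  exact: cset2_inj.
by apply: subset_leq_card; apply/fintype.subsetP => e /mapP[p /sE ? ->].
Qed.

Lemma cell_edge_lt c tau : c \in cells K rows -> c.1 < col K R c.2.1 c.2.2 tau < n.
Proof using NK rowsR rowsN.
move=> /(cells_lt NK rowsR rowsN)[c1 c2 c3]; have /andP[h ->] := col_range R tau c2 c3.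
by rewrite (leq_trans c1).
Qed.

(** The forced edges and one edge for each cell already exhaust the budget, so a cell with both
    edges would exceed it. *)
Lemma cell_exactly_one (E : {set {set 'I_n}}) c : #|E| <= budget K R rows ->
  (forall p, p \in forced K R -> edge p.1 p.2 \in E) ->
  (forall p, p \in ors K R rows -> exists2 x, x \in p.2 & edge p.1 x \in E) ->
  c \in cells K rows ->
  (edge c.1 (col K R c.2.1 c.2.2 true) \in E) = ~~ (edge c.1 (col K R c.2.1 c.2.2 false) \in E).
Proof using NK rowsR rowsC rowsN.
move=> Eb HF HO cc.
pose sel c tau := edge c.1 (col K R c.2.1 c.2.2 tau) \in E.
have one d : d \in cells K rows -> sel d true || sel d false.
  move=> dc; have [] := HO (d.1, [:: col K R d.2.1 d.2.2 true; col K R d.2.1 d.2.2 false]).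
    by rewrite mem_cat; apply/orP; left; apply/mapP; exists d.
  by move=> x; rewrite !inE /sel => /orP[]/eqP->->; rewrite ?orbT.
suff : ~~ (sel c true && sel c false).
  by move: (one c cc); rewrite /sel; case: (_ \in E); case: (_ \in E).
apply/negP => /andP[ct cf].
pose pick d := (d.1, col K R d.2.1 d.2.2 (sel d true)).
(* The edge put in front is the one of cell [c] that [pick] leaves out. *)
pose s := (c.1, col K R c.2.1 c.2.2 (~~ sel c true)) :: [seq pick d | d <- cells K rows] ++ forced K R.
have bound : size s <= #|E|.
  apply: edges_leq_card.
  - rewrite /= cat_uniq uniq_forced andbT mem_cat negb_or; apply/and3P; split.
    + apply/andP; split.
        apply/negP => /mapP[d dc [e1 e2]].
        have [_ _ b1] := cells_lt NK rowsR rowsN cc.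
        have [_ _ b2] := cells_lt NK rowsR rowsN dc.
        have [s1 s2 s3] := col_inj b1 b2 e2.
        have cd : c = d by move: e1 s1 s2; case: (c) (d) => ? [? ?] [? [? ?]] /= -> -> ->.
        by move: s3; rewrite -cd; case: (sel c true).
      rewrite mem_forced; apply/negP => /and3P[_ _].
      have [c1 c2 c3] := cells_lt NK rowsR rowsN cc.
      by have /andP[h _] := col_range R (~~ sel c true) c2 c3; rewrite c1 ltnNge h.
    + rewrite map_inj_in_uniq; first exact: uniq_cells NK rowsR rowsC rowsN.
      move=> d d' dc dc' [e1 e2].
      have [_ _ b1] := cells_lt NK rowsR rowsN dc.
      have [_ _ b2] := cells_lt NK rowsR rowsN dc'.
      have [s1 s2 _] := col_inj b1 b2 e2.
      by move: e1 s1 s2; case: (d) (d') => ? [? ?] [? [? ?]] /= -> -> ->.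
    + apply/hasPn => -[u v] uv; apply/negP => /mapP[d dc [e1 e2]].
      have [c1 c2 c3] := cells_lt NK rowsR rowsN dc.
      have /andP[h _] := col_range R (sel d true) c2 c3.
      by move: uv; rewrite mem_forced e1 e2 c1 [_ < K + R]ltnNge h !andbF.
  - move=> p; rewrite inE mem_cat => /or3P[/eqP->|/mapP[d dc ->]|].
    + exact: cell_edge_lt.
    + exact: cell_edge_lt.
    + by case: p => u v; rewrite mem_forced => /and3P[-> -> _].
  - move=> p; rewrite inE mem_cat => /or3P[/eqP->|/mapP[d dc ->]|/HF//] /=.
    + by rewrite ct.
    + by have := one d dc; rewrite /sel; case E1: (_ \in E) => //=.
move: bound; rewrite /s /= size_cat size_map ltnNge.
by rewrite (leq_trans Eb) // /budget addnC.
Qed.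

Lemma mem_link e x tau : e \in rows -> x \in slots e.2 ->
  (col K R x.1 (cb K x.2) tau, [:: K + e.1; (coord K x.2.1).1]) \in ors K R rows.
Proof.
move=> er xs; rewrite !mem_cat; apply/orP; right; apply/orP; right; apply/orP; left.
apply/allpairsPdep; exists e, (x, tau); split=> //.
by apply/allpairsP; exists (x, tau); split=> //; case: tau.
Qed.

Lemma mem_home_link h s b tau : h < K -> s < 3 -> b < K ->
  (h, [:: col K R 0 b tau; col K R s b (~~ tau)]) \in ors K R rows.
Proof.
move=> hK s3 bK; rewrite !mem_cat; apply/orP; right; apply/orP; left.
apply/allpairsP; exists ((h, (s, b)), tau); split=> //; last by case: tau.
by rewrite mem_home hK s3.
Qed.

Lemma mem_clause e : e \in rows ->
  (K + e.1, [seq col K R x.1 (cb K x.2) x.2.2 | x <- slots e.2]) \in ors K R rows.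
Proof.
move=> er; rewrite !mem_cat; do 3!(apply/orP; right).
by apply/mapP; exists e.
Qed.

(** The assignment is the negation of block 0 at home. A value selected in a clause row is reversed
    by the link to the home row, copied there to block 0 and reversed again by this reading. *)
Lemma gadget_sound (E : {set {set 'I_n}}) : #|E| <= budget K R rows ->
  (forall p, p \in forced K R -> edge p.1 p.2 \in E) ->
  (forall p, p \in ors K R rows -> exists2 x, x \in p.2 & edge p.1 x \in E) ->
  exists al, all (fun e => triple_true al e.2) rows.
Proof using NK rowsR rowsC rowsN.
move=> Eb HF HO.
pose sel r s b tau := edge r (col K R s b tau) \in E.
have xor r s b tau : (r, (s, b)) \in cells K rows -> sel r s b tau = ~~ sel r s b (~~ tau).
  by move=> /(cell_exactly_one Eb HF HO); rewrite /sel /=; case: tau => /= ->; rewrite ?negbK.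
pose al v := ~~ sel (coord K v).1 0 (coord K v).2 true; exists al.
apply/allP => e er.
have [z /mapP[x xs ->]] := HO _ (mem_clause er); rewrite -[_ \in E]/(sel _ _ _ _) /=.
suff lx : sel (K + e.1) x.1 (cb K x.2) x.2.2 -> lit_true al x.2.
  move/lx; move: xs; rewrite /triple_true !inE.
  by case/or3P => /eqP-> /= ->; rewrite ?orbT.
have [x3 xN hK bK] := slot_lt NK rowsN er xs.
have cc : (K + e.1, (x.1, cb K x.2)) \in cells K rows.
  by rewrite mem_cat; apply/orP; right; apply/allpairsPdep; exists e, x.
have home s : s < 3 -> ((coord K x.2.1).1, (s, cb K x.2)) \in cells K rows.
  by move=> s3; rewrite mem_cat mem_home hK s3 bK.
set sg := x.2.2; rewrite (xor _ _ _ _ cc) => n1.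
have n2 : sel (coord K x.2.1).1 x.1 (cb K x.2) (~~ sg).
  have [y] := HO _ (mem_link (~~ sg) er xs).
  rewrite !inE => /orP[]/eqP-> /=; rewrite cset2C -[_ \in E]/(sel _ _ _ _) //.
  by rewrite (negPf n1).
rewrite (xor _ _ _ _ (home _ x3)) negbK in n2.
have n3 : sel (coord K x.2.1).1 0 (cb K x.2) (~~ sg).
  have [y] := HO _ (mem_home_link (~~ sg) hK x3 bK).
  rewrite !inE => /orP[]/eqP-> /=; rewrite -[_ \in E]/(sel _ _ _ _) ?negbK //.
  by rewrite (negPf n2).
rewrite /lit_true /al -/(cb K x.2) -/sg; have := xor _ _ _ true (home 0 isT).
by move: n3; case: (sg) => h X; [rewrite X h | rewrite h].
Qed.

Lemma gadget_complete al : all (fun e => triple_true al e.2) rows ->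
  exists E : {set {set 'I_n}}, [/\ forall e, e \in E -> #|e| = 2, #|E| <= budget K R rows,
    forall p, p \in forced K R -> edge p.1 p.2 \in E
    & forall p, p \in ors K R rows -> exists2 x, x \in p.2 & edge p.1 x \in E].
Proof using NK rowsR rowsC rowsN.
move=> sat.
(* Every grid position has home cells, also those that belong to no variable; there [vh] is
   false. *)
pose vh (hb : nat * nat) := has (fun v => (coord K v == hb) && al v) (iota 0 N).
have vhE v : v < N -> vh (coord K v) = al v.
  move=> vN; apply/hasP/idP => [[w + /andP[/eqP e aw]]|av].
    rewrite mem_iota => /andP[_ wN].
    by rewrite -(coord_inj _ _ e) // ?(leq_trans _ NK).
  by exists v; rewrite ?mem_iota // eqxx.
pose hs := [seq (c.1, col K R c.2.1 c.2.2 (~~ vh (c.1, c.2.2))) | c <- home_cells K].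
pose cs := [seq (K + e.1, col K R x.1 (cb K x.2) (al x.2.1)) | e <- rows, x <- slots e.2].
pose es := hs ++ cs ++ forced K R.
have hsP h s b : h < K -> s < 3 -> b < K -> (h, col K R s b (~~ vh (h, b))) \in es.
  move=> hK s3 bK; rewrite mem_cat; apply/orP; left; apply/mapP.
  by exists (h, (s, b)); rewrite ?mem_home ?hK ?s3.
have csP e x : e \in rows -> x \in slots e.2 ->
    (K + e.1, col K R x.1 (cb K x.2) (al x.2.1)) \in es.
  move=> er xs; rewrite !mem_cat; apply/orP; right; apply/orP; left.
  by apply/allpairsPdep; exists e, x.
have esn p : p \in es -> p.1 < p.2 < n.
  rewrite !mem_cat => /or3P[/mapP[c ch ->]|/allpairsPdep[e [x [er xs ->]]]|].
  - by apply: cell_edge_lt; rewrite mem_cat ch.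
  - apply: (@cell_edge_lt (K + e.1, (x.1, cb K x.2))); rewrite mem_cat; apply/orP; right.
    by apply/allpairsPdep; exists e, x.
  - by case: p => u v; rewrite mem_forced => /and3P[-> -> _].
pose E := [set:: [seq edge p.1 p.2 | p <- es]].
have inE' p : p \in es -> edge p.1 p.2 \in E.
  by move=> pe; rewrite inE; apply/mapP; exists p.
exists E; split.
- move=> e; rewrite inE => /mapP[[u v] /esn /= /andP[uv vn] ->].
  have un := ltn_trans uv vn.
  have -> : edge u v = [set Ordinal un; Ordinal vn] by rewrite cset2.
  by rewrite cards2 -val_eqE /= ltn_eqF.
- rewrite cardsE (leq_trans (card_size _)) // size_map /es /budget /cells !size_cat.
  have -> : size hs = size (home_cells K) by rewrite size_map.
  have -> : size cs = size (clause_cells K rows) by rewrite !size_allpairs_dep.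
  by rewrite addnA addnC.
- by move=> p pf; apply: inE'; rewrite !mem_cat pf !orbT.
move=> p; rewrite !mem_cat => /or4P[].
- case/mapP => c; rewrite mem_cat => /orP[|/allpairsPdep[e [x [er xs ->]]]] .
    case: c => h [s b]; rewrite mem_home => /and3P[hK s3 bK] -> /=.
    have := inE' _ (hsP h s b hK s3 bK); case: (~~ _) => H.
      by exists (col K R s b true); rewrite // !inE eqxx.
    by exists (col K R s b false); rewrite // !inE eqxx orbT.
  move=> -> /=; have := inE' _ (csP e x er xs); case: (al _) => H.
    by exists (col K R x.1 (cb K x.2) true); rewrite // !inE eqxx.
  by exists (col K R x.1 (cb K x.2) false); rewrite // !inE eqxx orbT.
- case/allpairsP => -[[h [s b]] tau] [+ _ ->]; rewrite mem_home => /and3P[hK s3 bK] /=.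
  have := inE' _ (hsP h s b hK s3 bK); have := inE' _ (hsP h 0 b hK isT bK).
  case: (~~ vh _) tau => [] [] h0 hs'; rewrite /=.
  + by exists (col K R 0 b true); rewrite // !inE eqxx.
  + by exists (col K R s b true); rewrite // !inE eqxx orbT.
  + by exists (col K R s b false); rewrite // !inE eqxx orbT.
  + by exists (col K R 0 b false); rewrite // !inE eqxx.
- case/allpairsPdep => e [y [er /allpairsP[[x tau] [+ _ ->]] ->]].
  rewrite -[(x, tau).1]/x => xs /=; have [x3 xN hK bK] := slot_lt NK rowsN er xs.
  have := inE' _ (csP e x er xs); have := inE' _ (hsP _ x.1 _ hK x3 bK).
  rewrite /cb -surjective_pairing vhE //= -/(cb K x.2).
  (* Clause cell and home cell carry opposite values, so for each [tau] one of the two edges is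
     present. *)
  case: (al _) tau => [] [] h0 h1.
  + by exists (K + e.1); [rewrite !inE eqxx | rewrite cset2C].
  + by exists (coord K x.2.1).1; [rewrite !inE eqxx orbT | rewrite cset2C].
  + by exists (coord K x.2.1).1; [rewrite !inE eqxx orbT | rewrite cset2C].
  + by exists (K + e.1); [rewrite !inE eqxx | rewrite cset2C].
- case/mapP => e er ->.
  have [x xs lx] : exists2 x, x \in slots e.2 & lit_true al x.2.
    have := allP sat e er; rewrite /triple_true => /or3P[] h.
    + by exists (0, e.2.1.1); rewrite ?inE ?eqxx.
    + by exists (1, e.2.1.2); rewrite ?inE ?eqxx ?orbT.
    + by exists (2, e.2.2); rewrite ?inE ?eqxx ?orbT.
  exists (col K R x.1 (cb K x.2) x.2.2).
    by apply/mapP; exists x.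
  by move: lx (inE' _ (csP e x er xs)); rewrite /lit_true => /eqP ->.
Qed.

Lemma gadget_correct :
  (exists E : {set {set 'I_n}}, [/\ forall e, e \in E -> #|e| = 2, #|E| <= budget K R rows
    & forall p, p \in constraints K R rows -> has_spanning_star E (cset n (p.1 :: p.2))])
  <-> sat3 [seq e.2 | e <- rows].
Proof using NK rowsR rowsC rowsN.
rewrite /sat3; split=> [[E [_ Eb /constraintsP[HF HO]]]|[al]].
  by have [al H] := gadget_sound Eb HF HO; exists al; rewrite all_map.
rewrite all_map => /gadget_complete[E [E2 Eb HF HO]]; exists E; split=> //.
exact/constraintsP.
Qed.

End GadgetCorrect.

(** * The reduction as a polynomial-time function *)

(** Mirrors the prescribed encoding with pairs and lists; [false] is the sign of the edge budget. *)
Definition stars_data (K R : nat) (rows : seq (nat * triple)) :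
    nat * (seq (seq bool) * (seq (seq bool) * ((bool * nat) * nat))) :=
  (nv K R,
   ([seq [seq u != v | v <- iota 0 (nv K R)] | u <- iota 0 (nv K R)],
    (undup [seq [seq v \in p.1 :: p.2 | v <- iota 0 (nv K R)] | p <- constraints K R rows],
     ((false, budget K R rows), (budget K R rows).+1)))).

Definition stars_reduce (D : nat) (x : (nat * seq triple) * state) :=
  stars_data (side x.1.1) (3 * (side x.1.1 * (D * 2))).+1
    (place (side x.1.1) (3 * (side x.1.1 * (D * 2))).+1 (leaf_cnf x.1.2 x.2)).

(** Successors and instance are produced in every case and the flag tells which to use; the default
    [(x.2, x.2)] appears only when no branching applies. *)
Definition next (t1 t2 D : nat) (x : (nat * seq triple) * state) :=
  (~~ nilp (branches t1 t2 x.1.1 x.1.2 x.2),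
   (((x.1, (head (x.2, x.2) (branches t1 t2 x.1.1 x.1.2 x.2)).1),
     (x.1, (head (x.2, x.2) (branches t1 t2 x.1.1 x.1.2 x.2)).2)),
    stars_reduce D x)).

Lemma PT_branches t1 t2 :
  PT (fun x : (nat * seq triple) * state => branches t1 t2 x.1.1 x.1.2 x.2).
Proof.
rewrite /branches /branch1 /branch2 /branch3 /thirds /links /nbrs /swap /tlive /lits; pt.
Qed.

Lemma PT_leaf_cnf : PT (fun x : (nat * seq triple) * state => leaf_cnf x.1.2 x.2).
Proof. rewrite /leaf_cnf /blive /tlive; pt. Qed.

(** Covers the default value as well, because polynomial time has to hold on all inputs and not only
    on sparse formulas. *)
Lemma free_row_leq K R t acc : free_row K R t acc <= R.
Proof.
rewrite /free_row; set s := [seq _ <- _ | _].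
have : {subset s <= iota 0 R} by move=> r; rewrite mem_filter => /andP[].
case: s => // r s /(_ r (mem_head _ _)); rewrite mem_iota => /andP[_]; exact: ltnW.
Qed.

Lemma PT_place : PT (fun x : (nat * nat) * seq triple => place x.1.1 x.1.2 x.2).
Proof.
apply: (PT_foldr (f := fun x t acc => (free_row x.1.1 x.1.2 t acc, t) :: acc)
  (z := fun=> [::]) (l := fun x : (nat * nat) * seq triple => x.2)).
- rewrite /free_row /conflict /cb /coord; pt.
- pt.
- pt.
exists (fun x => (x.1.2 + 2) * sz x.2 + sz x.2).
  apply: pbD; last by apply: PT_sz; pt.
  apply: pbM; last by apply: PT_sz; pt.
  apply: pbD; last exact: pb_const.
  by apply: (pb_le (PT_sz (PT_snd (PT_fst PT_id)))) => x; rewrite sz_nat.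
move=> [[K R] F] s1 s2 /= ->; rewrite sz_cat.
apply: leq_trans (_ : (R + 2) * sz s2 + sz s2 <= _); last by rewrite leq_add // ?leq_mul ?leq_addl.
elim: s2 => // t s2 IH; rewrite [foldr _ _ _]/= !sz_cons sz_pair sz_nat /=.
by have := free_row_leq K R t (foldr (fun t acc => (free_row K R t acc, t) :: acc) [::] s2); nia.
Qed.

Lemma PT_stars_data : PT (fun x : (nat * nat) * seq (nat * triple) => stars_data x.1.1 x.1.2 x.2).
Proof.
rewrite /stars_data /constraints /budget /ors /cell_ors /home_ors /link_ors /clause_ors /cells
 /clause_cells /home_cells /slots /forced /nv /col /cb /coord; pt.
Qed.

Lemma PT_next t1 t2 D : PT (next t1 t2 D).
Proof.
assert (HB := PT_branches t1 t2).
assert (HK : PT (fun x : (nat * seq triple) * state => side x.1.1)) by (rewrite /side; pt).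
rewrite /next; apply: PT_pair; first by pt.
apply: PT_pair; first by pt.
rewrite /stars_reduce.
assert (HR : PT (fun x : (nat * seq triple) * state => (3 * (side x.1.1 * (D * 2))).+1)) by pt.
assert (HP := PT_comp PT_place (PT_pair (PT_pair HK HR) PT_leaf_cnf)).
exact: (PT_comp PT_stars_data (PT_pair (PT_pair HK HR) HP)).
Qed.

(** * The gadget as an instance of the problem *)

Section GadgetInstance.
Variables (RR : realType) (K R : nat) (rows : seq (nat * triple)).
Local Notation n := (nv K R).

Definition all_pairs (m : nat) : {set {set 'I_m}} := [set e : {set 'I_m} | #|e| == 2].

Lemma all_pairs_card m (e : {set 'I_m}) : e \in all_pairs m -> #|e| = 2.
Proof. by rewrite inE => /eqP. Qed.

(** Different constraints may have the same vertex set, hence [undup]. The successor makes the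
    weight budget positive; with unit weights the edge bound implies the weight bound. *)
Definition gadget_instance : instance RR :=
  @Instance RR n (all_pairs n) (@all_pairs_card n)
    (undup [seq cset n (p.1 :: p.2) | p <- constraints K R rows]) (undup_uniq _)
    (fun=> 1%R) (fun _ _ => ler01) (Posz (budget K R rows))
    ((budget K R rows).+1%:R)%R (ltr0Sn _ _).

Lemma gadget_unweighted : unweighted gadget_instance.
Proof. by []. Qed.

Lemma gadget_clique : is_clique gadget_instance.
Proof. by move=> u v uv; rewrite inE cards2 uv. Qed.

Lemma card_cset m (s : seq nat) : #|cset m s| <= size s.
Proof.
rewrite cardE -(size_map val); apply: uniq_leq_size.
  by rewrite (map_inj_uniq val_inj) enum_uniq.
by move=> x /mapP[y]; rewrite mem_enum inE => + ->.
Qed.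

Lemma gadget_size4 C : C \in communities gadget_instance -> #|C| <= 4.
Proof.
rewrite mem_undup => /mapP[p pc ->]; apply: leq_trans (card_cset _ _) _ => /=.
move: pc; rewrite !mem_cat => /or4P[/mapP[q _ ->]|/mapP[c _ ->]|/allpairsP[q [_ _ ->]]|/orP[|]] //.
  by case/allpairsPdep => e [x [_ _ ->]].
by case/mapP => e _ ->.
Qed.

Lemma gadget_stars : stars_nws gadget_instance <->
  (exists E : {set {set 'I_n}}, [/\ forall e, e \in E -> #|e| = 2, #|E| <= budget K R rows
    & forall p, p \in constraints K R rows -> has_spanning_star E (cset n (p.1 :: p.2))]).
Proof.
split=> [[E [/fintype.subsetP Ee Eb _ HC]]|[E [E2 Eb HC]]]; exists E; split=> //.
- by move=> e /Ee /all_pairs_card.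
- by move=> p pc; apply: HC; rewrite mem_undup; apply/mapP; exists p.
- by apply/fintype.subsetP => e /E2 /eqP; rewrite inE.
- by rewrite /= sumr_const ler_nat (leq_trans Eb).
- by move=> C; rewrite mem_undup => /mapP[p pc ->]; apply: HC.
Qed.

Lemma enc_seq_map (X Y : Type) (f : X -> Y) (g : Y -> tree) (s : seq X) :
  enc_seq g [seq f x | x <- s] = enc_seq (fun x => g (f x)) s.
Proof. by elim: s => //= x s ->. Qed.

Lemma enc_ord m (X : Type) {eX : Enc X} (f : 'I_m -> tree) (g : nat -> X) :
  (forall u, f u = enc (g (val u))) ->
  enc_seq f (enum 'I_m) = enc [seq g u | u <- iota 0 m].
Proof.
move=> H; rewrite -val_enum_ord -map_comp -[RHS]/(enc_seq enc _) enc_seq_map.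
by elim: (enum _) => //= x s ->; rewrite H.
Qed.

Lemma enc_gadget : enc_unweighted gadget_instance = enc (stars_data K R rows).
Proof.
rewrite /enc_unweighted /stars_data; congr Node; congr Node.
  apply: enc_ord => u; apply: enc_ord => v.
  by rewrite [edges _]/= inE cards2 -val_eqE; case: (_ != _).
congr Node.
(* Indicator vectors determine their sets, so duplicates may be removed before or after passing to
   them. *)
pose row (C : {set 'I_n}) : seq bool := [seq v \in C | v <- enum 'I_n].
have row_inj : injective row.
  move=> C C' E; apply/setP => v; have /(congr1 (fun s => nth false s v)) := E.
  rewrite /row /= (nth_map v) ?size_enum_ord // (nth_map v false (mem C')) ?size_enum_ord //.
  by rewrite !nth_ord_enum.
transitivity (enc (undup [seq row C | C <- [seq cset n (p.1 :: p.2) | p <- constraints K R rows]])).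
  rewrite undup_map_inj // -[RHS]/(enc_seq enc _) enc_seq_map.
  by congr (foldr _ _ _); apply: funext => C; rewrite /row -[enc _]/(enc_seq enc_bool _) enc_seq_map.
congr (enc_seq enc (undup _)); rewrite -map_comp; apply: eq_map => p.
  by rewrite /row /= -val_enum_ord -map_comp; apply: eq_map => v /=; rewrite inE.
congr Node; by rewrite /= natrK.
Qed.

End GadgetInstance.

(** * Size and correctness of the instances at the leaves *)

Section LeafInstance.
Variables (RR : realType) (t1 t2 : nat).
Local Notation D := (t1 + t2).+1.

Definition leaf_instance (x : (nat * seq triple) * state) : instance RR :=
  gadget_instance RR (side x.1.1) (3 * (side x.1.1 * (D * 2))).+1
    (place (side x.1.1) (3 * (side x.1.1 * (D * 2))).+1 (leaf_cnf x.1.2 x.2)).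

(** With [a = 7 + 6 * D] there are [a * K + 1] vertices, and [K * K <= 4 * N], so their number
    squared is at most [8 * a ^ 2 * N + 2]. It enters twice, the second time for the forced
    communities; 36 and [20 * D] come from the [9 * K * K] and [10 * size F] bounding the others. *)
Definition leaf_const : nat := 16 * (7 + 6 * D) ^ 2 + 36 + 20 * D + 4.

Lemma enc_leaf x : enc_unweighted (leaf_instance x) = enc (stars_reduce D x).
Proof. exact: enc_gadget. Qed.

Lemma leaf_instance_correct N T s : wfT N T -> wf t1 N s -> branches t1 t2 N T s = [::] ->
  stars_nws (leaf_instance ((N, T), s)) <-> exists al, models T s al.
Proof.
move=> WT W L; rewrite /leaf_instance gadget_stars /=.
set K := side N; set R := (3 * _).+1; set F := leaf_cnf T s.
have NK : N <= K * K by have [] := side_spec N.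
have /andP[rR rC] : all (fun e => e.1 < R) (place K R F) && pairwise (compatible K) (place K R F).
  apply: placeP => t tF; rewrite ltnS; apply: count_conflict NK _ _ _ _ => [u|v|v|v].
  - by move=> uF; apply: (leaf_lits WT W uF).
  - by apply: (count_var (f := fun u => u.1.1)) => l; apply: leaf_count_slot1 WT W L l.
  - by apply: (count_var (f := fun u => u.1.2)) => l; apply: leaf_count_slot2 WT W L l.
  - by apply: (count_var (f := fun u => u.2)) => l; apply: leaf_count_slot3 WT W L l.
rewrite (gadget_correct NK rR rC).
  by rewrite place_snd; split=> -[al H]; exists al; [rewrite -leaf_models | rewrite leaf_models].
move=> e er; apply: (leaf_lits WT W); rewrite -/F -(place_snd K R F).
by apply/mapP; exists e.
Qed.

(** Per grid position 3 cell and 6 home disjunctions; per clause 3 cell, 6 link and 1 clause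
    disjunction. *)
Lemma size_constraints K R rows :
  size (constraints K R rows) <= nv K R ^ 2 + 9 * K * K + 10 * size rows.
Proof.
rewrite /constraints /ors !size_cat size_map.
have : size (forced K R) <= nv K R ^ 2.
  rewrite size_filter (leq_trans (count_size _ _)) // size_allpairs size_iota.
  by rewrite mulnn.
have -> : size (cell_ors K R rows) = 3 * K * K + 3 * size rows.
  by rewrite size_map size_cat size_home size_clause_cells.
have -> : size (home_ors K R) = 6 * K * K.
  by rewrite size_allpairs size_home mulnC !mulnA.
have -> : size (link_ors K R rows) = 6 * size rows.
  by rewrite size_allpairs_dep; elim: rows => //= e rows ->; rewrite mulnS.
have -> : size (clause_ors K R rows) = size rows by rewrite size_map.
by rewrite -!mulnA; move: (K * K) (nv K R ^ 2) (size (forced K R)) => k2 v2 f; lia.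
Qed.

Lemma leaf_instance_size N T s : wfT N T -> wf t1 N s -> branches t1 t2 N T s = [::] ->
  nverts (leaf_instance ((N, T), s)) ^ 2 + ncomms (leaf_instance ((N, T), s))
    <= leaf_const * N.+1.
Proof.
move=> WT W L; rewrite /leaf_instance /ncomms /=.
set K := side N; set R := (3 * _).+1; set F := leaf_cnf T s.
apply: leq_trans (_ : nv K R ^ 2 + (nv K R ^ 2 + 9 * K * K + 10 * size F) <= _).
  rewrite leq_add2l (leq_trans (size_undup _)) // size_map (leq_trans (size_constraints _ _ _)) //.
  by rewrite size_place.
have sF : size F <= D * 2 * N := size_leaf WT W L.
have K2 : K * K <= 4 * N := side_sq N.
have -> : nv K R = (7 + 6 * D) * K + 1.
  by rewrite /nv /R; move: (D) => d; nia.
rewrite /leaf_const; move: sF K2; move: (D) (7 + 6 * D) => d a sF K2.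
have sq : (a * K + 1) ^ 2 <= 8 * a ^ 2 * N + 2.
  rewrite -!mulnn; apply: leq_trans (_ : 2 * (a * a) * (K * K) + 2 <= _); first by nia.
  by rewrite leq_add2r; nia.
move: sq; rewrite -(mulnA 9) -(mulnA 8) mulnS !mulnDl -!mulnA.
move: sF; rewrite -mulnA mulnCA.
by move: (a ^ 2 * N) (a ^ 2) (d * N) (K * K) K2 ((a * K + 1) ^ 2) (size F) => p q r k K2 S f; lia.
Qed.

End LeafInstance.

(** * From the input formula to the root of the search *)

(* Short clauses are padded by repetition; the value on the empty clause is junk,
   and [start] answers such formulas directly. *)
Definition pad (cl : seq lit) : triple :=
  (head (0, true) cl, nth (head (0, true) cl) cl 1, nth (head (0, true) cl) cl 2).

(** All six orders are listed to obtain the closure conditions of [wfT]. *)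
Definition orders (t : triple) : seq triple :=
  let: (a, b, c) := t in
  [:: (a, b, c); (a, c, b); (b, a, c); (b, c, a); (c, a, b); (c, b, a)].

Definition triples_of (phi : seq (seq lit)) : seq triple :=
  undup (flatten [seq orders (pad cl) | cl <- phi]).

Definition start (x : nat * seq (seq lit)) : seq ((nat * seq triple) * state) :=
  if has (@nilp lit) x.2 then [::] else [:: ((x.1, triples_of x.2), ([::], [::]))].

Lemma PT_start : PT start.
Proof. rewrite /start /triples_of /pad /orders; pt. Qed.

Definition nat_lit n (l : literal n) : lit := (val l.1, l.2).
Definition nat_cnf n (phi : cnf n) : seq (seq lit) := [seq [seq nat_lit l | l <- cl] | cl <- phi].

Lemma enc_nat_cnf n (phi : cnf n) : enc_cnf phi = enc (n, nat_cnf phi).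
Proof.
congr Node; rewrite /= /nat_cnf; elim: phi => //= cl phi ->; congr Node.
by elim: cl => //= l cl ->.
Qed.

Lemma pad_mem cl l : cl != [::] -> l \in [:: (pad cl).1.1; (pad cl).1.2; (pad cl).2] -> l \in cl.
Proof.
case: cl => [//|a [|b [|c cl]]] _; rewrite /pad /= !inE ?orbb //.
  by case/or3P => /eqP->; rewrite eqxx ?orbT.
by case/or3P => /eqP->; rewrite eqxx ?orbT.
Qed.

Lemma pad_true al cl : cl != [::] -> size cl <= 3 -> triple_true al (pad cl) = has (lit_true al) cl.
Proof.
case: cl => [//|a [|b [|c [|d cl]]]] // _ _; rewrite /triple_true /pad /= ?orbb ?orbF //.
by case: (lit_true al a); case: (lit_true al b).
Qed.

Lemma triples_true al phi : all (triple_true al) (triples_of phi) = all (fun cl => triple_true al (pad cl)) phi.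
Proof.
rewrite (eq_all_r (mem_undup _)).
elim: phi => // cl phi IH.
rewrite -[flatten _]/(orders (pad cl) ++ flatten [seq orders (pad c) | c <- phi]) all_cat IH.
rewrite -[RHS]/(triple_true al (pad cl) && _); congr andb.
case: (pad cl) => -[a b] c; rewrite /triple_true /=.
by case: (lit_true al a) (lit_true al b) (lit_true al c) => [] [] [].
Qed.

Section Start.
Variables (n : nat) (phi : cnf n).
Hypothesis phi3 : is_3cnf phi.
Hypothesis nonil : ~~ has (@nilp lit) (nat_cnf phi).

Lemma nat_cnf_nonil cl : cl \in phi -> [seq nat_lit l | l <- cl] != [::].
Proof using nonil.
move=> clp; have := hasPn nonil [seq nat_lit l | l <- cl].
by rewrite /nilp size_eq0; apply; apply: map_f.
Qed.

Lemma wfT_start : wfT n (triples_of (nat_cnf phi)).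
Proof using nonil.
split.
- exact: undup_uniq.
- move=> t; rewrite mem_undup => /flatten_mapP[cl /mapP[cl0 clp ->]].
  have H l : l \in [:: (pad [seq nat_lit l | l <- cl0]).1.1; (pad [seq nat_lit l | l <- cl0]).1.2;
     (pad [seq nat_lit l | l <- cl0]).2] -> l \in lits n.
    by move/(pad_mem (nat_cnf_nonil clp)) => /mapP[x _ ->]; rewrite mem_lits ltn_ord.
  move: H; case: (pad _) => -[a b] c /= H.
  have [ha hb hc] : [/\ a \in lits n, b \in lits n & c \in lits n].
    by split; apply: H; rewrite !inE eqxx ?orbT.
  by rewrite !inE => /or4P[/eqP->|/eqP->|/eqP->|/or3P[]/eqP->]; rewrite /= ha hb hc.
- move=> a b c; rewrite !mem_undup => /flatten_mapP[cl clp h]; apply/flatten_mapP; exists cl => //.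
  move: h; case: (pad cl) => -[x y] z; rewrite !inE.
  by case/or4P => [|||/or3P[]] /eqP[-> -> ->]; rewrite eqxx ?orbT.
- move=> a b c; rewrite !mem_undup => /flatten_mapP[cl clp h]; apply/flatten_mapP; exists cl => //.
  move: h; case: (pad cl) => -[x y] z; rewrite !inE.
  by case/or4P => [|||/or3P[]] /eqP[-> -> ->]; rewrite eqxx ?orbT.
Qed.

Lemma models_start :
  (exists al, models (triples_of (nat_cnf phi)) ([::], [::]) al) <-> satisfiable phi.
Proof using phi3 nonil.
have E al : models (triples_of (nat_cnf phi)) ([::], [::]) al =
    all (fun cl : seq (literal n) => has (fun l => al (val l.1) == l.2) cl) phi.
  rewrite /models /= triples_true all_map; apply: eq_in_all => cl clp /=.
  by rewrite pad_true ?size_map ?phi3 ?nat_cnf_nonil // has_map.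
split=> [[al]|[a H]].
  rewrite E => /allP H; exists (fun i => al (val i)) => cl /H /hasP[l lc /eqP e].
  by exists l.
exists (fun v => if insub v is Some i then a i else false); rewrite E.
apply/allP => cl /H [l lc e]; apply/hasP; exists l => //.
by rewrite valK e.
Qed.

End Start.

Lemma nil_unsat n (phi : cnf n) : has (@nilp lit) (nat_cnf phi) -> ~ satisfiable phi.
Proof.
case/hasP => _ /mapP[cl clp ->] + [a /(_ cl clp) [l lc _]].
by case: cl lc {clp}.
Qed.

Lemma sz_leq (A : eqType) {eA : Enc A} (s : seq A) c :
  (forall a, a \in s -> sz a <= c) -> sz s <= size s * c.+1.
Proof.
elim: s => // a s IH H; rewrite sz_cons mulSn -addSn leq_add ?ltnS ?H ?mem_head //.
by apply: IH => b bs; apply: H; rewrite inE bs orbT.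
Qed.

Definition state_size (n m : nat) : nat :=
  (n + 6 * m * (3 * n + 6)).+1 + (2 * n * (n + 2) + (2 * n) ^ 2 * (2 * n + 4)).+2.

(** Units and pairs form duplicate-free lists over [lits n], so states stay polynomial however deep
    the search goes, and each step of it costs polynomial time. *)
Lemma sz_state t1 n (phi : seq (seq lit)) s : wfT n (triples_of phi) -> wf t1 n s ->
  sz ((n, triples_of phi), s) <= state_size n (size phi).
Proof.
move=> [_ TL _ _] [/andP[uU uB] UL BL _ _].
have szl l : l \in lits n -> sz l <= n.+1.
  case: l => v b; rewrite mem_lits sz_pair sz_nat /= => vn.
  by have := sz_bool b; move: (sz b) => k; lia.
have hT : sz (triples_of phi) <= 6 * size phi * (3 * n + 6).
  apply: leq_trans (@sz_leq _ _ _ (3 * n + 5) _) _.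
    move=> [[a b] c] /TL/and3P[/szl + /szl + /szl +]; rewrite !(sz_pair (_, _)) /=.
    by move: (sz a) (sz b) (sz c) => x y z; lia.
  rewrite -addnS leq_mul2r; apply/orP; right; apply: leq_trans (size_undup _) _.
  elim: (phi) => // cl p IH.
  rewrite -[flatten _]/(orders (pad cl) ++ flatten [seq orders (pad c) | c <- p]) size_cat.
  by rewrite mulnS leq_add.
have hU : sz s.1 <= 2 * n * (n + 2).
  apply: leq_trans (@sz_leq _ _ _ n.+1 _) _; first by move=> l /UL /szl.
  by rewrite addn2 leq_mul2r; apply/orP; right; rewrite mulnC -size_lits uniq_leq_size.
have hB : sz s.2 <= (2 * n) ^ 2 * (2 * n + 4).
  apply: leq_trans (@sz_leq _ _ _ (2 * n + 3) _) _.
    move=> [a b] /BL/andP[/szl + /szl +]; rewrite (sz_pair (_, _)) /=.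
    by move: (sz a) (sz b) => x y; lia.
  rewrite -addnS leq_mul2r; apply/orP; right.
  apply: leq_trans (_ : size [seq (a, b) | a <- lits n, b <- lits n] <= _); last first.
    by rewrite size_allpairs size_lits mulnn mulnC.
  apply: uniq_leq_size => // -[a b] /BL/andP[? ?].
  by apply/allpairsP; exists (a, b).
rewrite (sz_pair (_, _)) (sz_pair (n, _)) (sz_pair s) sz_nat /= /state_size.
by move: hT hU hB; move: (sz _) (sz s.1) (sz s.2) => x y z; lia.
Qed.

(** * The search program *)

(** The solver is specified only on an initial store, so its variables are reset before every
    call. *)
Fixpoint clear (m : nat) : cmd :=
  if m is m'.+1 then Seq (Assign m ENil) (clear m') else Assign 0 (EVar 0).

Lemma runs_clear m s : runs (clear m) s (4 * m + 2) (fun s' =>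
  [/\ s' 0 = s 0, forall y, 0 < y <= m -> s' y = Leaf & forall y, m < y -> s' y = s y]).
Proof.
elim: m s => [|m IH] s.
  apply: (runs_assign (e := EVar 0)); rewrite /upd /=; split=> // y; first by case: y.
  by case: y.
apply: (@runs_weak _ _ (2 + (4 * m + 2)).+1) (fun _ h => h); last by lia.
apply: (runs_seq (runs_assign (e := ENil) (P := fun s' => s' = upd s m.+1 Leaf) _)) => // _ ->.
apply: runs_weak (IH _) (leqnn _) _ => s' [h0 h1 h2]; split=> [|y /andP[y0 ym]|y ym].
- by rewrite h0.
- move: ym; rewrite leq_eqVlt => /predU1P[->|ym]; last by rewrite h1 // y0.
  by rewrite h2 // /upd eqxx.
- by rewrite h2 ?(ltnW ym) // /upd gtn_eqF.
Qed.

Section MainLoop.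
Context {X Y : Type} {eX : Enc X} {eY : Enc Y}.
Variables (nxt : X -> bool * ((X * X) * Y)) (cn p : cmd) (kS : nat) (Tn Tp : nat).
Variables (ok good : X -> Prop) (w : X -> nat).
Hypotheses (cn_kS : cvars cn <= kS) (p_kS : cvars p <= kS) (kS_gt1 : 1 < kS).
Hypothesis cn_runs : forall x s, ok x -> s 0 = enc x ->
  runs cn s Tn (fun s' => s' 0 = enc (nxt x)).
Hypothesis branch_ok : forall x, ok x -> (nxt x).1 ->
  [/\ ok (nxt x).2.1.1, ok (nxt x).2.1.2, w (nxt x).2.1.1 + w (nxt x).2.1.2 < w x
    & good x <-> good (nxt x).2.1.1 \/ good (nxt x).2.1.2].
Hypothesis leaf_ok : forall x, ok x -> ~~ (nxt x).1 ->
  0 < w x /\ exists t s, [/\ exec p (init_store (enc (nxt x).2.2)) t s, t <= Tp & s 0 <> Leaf <-> good x].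

Local Notation kF := kS.+1.

(** Depth-first search with the stack of open states in [kS] and the answer in [kF]. A satisfiable
    leaf sets the answer and empties the stack, which ends the loop. *)
Definition loop_body : cmd :=
  Seq (Assign 0 (EHd (EVar kS))) (Seq cn (If (EHd (EVar 0))
    (Assign kS (ECons (EHd (EHd (ETl (EVar 0))))
       (ECons (ETl (EHd (ETl (EVar 0)))) (ETl (EVar kS)))))
    (Seq (Assign kS (ETl (EVar kS))) (Seq (Assign 0 (ETl (ETl (EVar 0))))
      (Seq (clear kS.-1) (Seq p (If (EVar 0)
        (Seq (Assign kF (ECons ENil ENil)) (Assign kS ENil))
        (Assign kF ENil)))))))).

Definition body_time : nat := Tn + Tp + 4 * kS + 50.

Fixpoint okS (l : seq X) : Prop := if l is x :: l' then ok x /\ okS l' else True.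
Fixpoint goodS (l : seq X) : Prop := if l is x :: l' then good x \/ goodS l' else False.

(** Unless the search stops, the total weight of the stack decreases: a branching replaces [x] by
    two states of smaller total weight, a leaf removes a positive weight. *)
Lemma runs_body x l s : ok x -> okS l -> s kS = enc (x :: l) -> s kF = Leaf ->
  runs loop_body s body_time (fun s' =>
    (exists l', [/\ s' kS = enc l', s' kF = Leaf, okS l',
       sumn (map w l') < sumn (map w (x :: l)) & goodS l' <-> goodS (x :: l)]) \/
    [/\ s' kS = Leaf, s' kF <> Leaf & goodS (x :: l)]).
Proof using cn_kS p_kS kS_gt1 cn_runs branch_ok leaf_ok.
move=> okx okl sS sF.
have kS0 : (kS == 0) = false by rewrite gtn_eqF // ltnW.
have FS : (kF == kS) = false by rewrite gtn_eqF.
have SF : (kS == kF) = false by rewrite ltn_eqF.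
apply: runs_weak (_ : runs _ _ (3 + (Tn + (2 + (12 + (Tp + 4 * kS + 30))).+1).+1).+1 _) _ (fun _ h => h); last by rewrite /body_time; lia.
apply: (runs_seq (runs_assign (P := fun s1 => [/\ s1 0 = enc x, s1 kS = enc (x :: l) & s1 kF = Leaf]) _)).
  by rewrite /upd /= kS0 sS sF.
move=> {s sS sF} s [s0 sS sF]; apply: (runs_seq (runs_frame (cn_runs okx s0))) => s1 [s10 fr].
have {}sS : s1 kS = enc (x :: l) by rewrite fr.
have {}sF : s1 kF = Leaf by rewrite fr // leqW.
apply: (runs_if (e := EHd (EVar 0))) => /=; rewrite s10 [hd _]/=; case E: (nxt x).1 => // _.
  apply: runs_weak (runs_assign (P := fun s' => [/\ s' kS = enc [:: (nxt x).2.1.1, (nxt x).2.1.2 & l] & s' kF = Leaf]) _) _ _.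
  - by rewrite /upd /= eqxx FS s10 sS sF.
  - by rewrite /=; lia.
  move=> s' [hS hF]; left; exists [:: (nxt x).2.1.1, (nxt x).2.1.2 & l].
  have [ok1 ok2 wlt gd] := branch_ok okx E; split=> //=; first by rewrite addnA ltn_add2r.
  by rewrite gd; tauto.
have [wx [t [sp [ex tT ans]]]] := leaf_ok okx (negbT E).
apply: runs_weak (_ : runs _ _ (3 + (4 + (4 * kS.-1 + 2 + (Tp + (1 + 7).+1).+1).+1).+1).+1 _) _ (fun _ h => h); last by lia.
apply: (runs_seq (runs_assign (P := fun s' => [/\ s' 0 = enc (nxt x), s' kS = enc l & s' kF = Leaf]) _)).
  by rewrite /upd /= eqxx FS eq_sym kS0 s10 sS sF.
move=> {sS sF s10 fr s0} s2 [s20 sS sF].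
apply: (runs_seq (runs_assign (P := fun s' => [/\ s' 0 = enc (nxt x).2.2, s' kS = enc l & s' kF = Leaf]) _)).
  by rewrite /upd /= kS0 s20 sS sF.
move=> {s2 s20 sS sF} s2 [s20 sS sF].
apply: (runs_seq (runs_clear kS.-1 s2)) => s3 [s30 s3c s3f].
have mS : kS.-1 < kS by rewrite prednK // ltnW.
have {}sS : s3 kS = enc l by rewrite s3f.
have {}sF : s3 kF = Leaf by rewrite s3f // ltnW.
(* After clearing, the store agrees below [kS] with the initial store for which the run of [p] is
   given. *)
have [|s4 ex4 ag] := exec_agree ex (k := kS) (s2 := s3) p_kS.
  move=> y yk; rewrite /init_store /upd; case: eqP => [->|/eqP y0]; first by rewrite s30.
  by apply: s3c; rewrite lt0n y0 -ltnS prednK // ltnW.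
have fr4 := exec_frame ex4.
have {}sS : s4 kS = enc l by rewrite fr4.
have {}sF : s4 kF = Leaf by rewrite fr4 // leqW.
have {}ans : s4 0 <> Leaf <-> good x by rewrite ag // ltnW.
apply: (runs_seq (P := fun s' => s' = s4)); first by exists t, s4.
move=> _ ->; apply: (runs_if (e := EVar 0)) => /= h.
  apply: (@runs_weak _ _ (4 + 2).+1) (leqnn _) (fun _ h => h).
  apply: (runs_seq (runs_assign (e := ECons _ _) (P := fun s' => s' kF <> Leaf) _)).
    by rewrite /upd eqxx.
  move=> s5 s5F; apply: (runs_assign (e := ENil)); right; rewrite /upd FS eqxx; split=> //.
  by left; apply/ans.
apply: (@runs_weak _ _ 2) => //; last exact: (fun _ h => h).
apply: (runs_assign (e := ENil)); left; exists l; rewrite /upd SF eqxx; split=> //=.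
  by rewrite -[X in X < _]add0n ltn_add2r.
split; first by right.
by case=> // /ans.
Qed.

Lemma runs_loop l s : okS l -> s kS = enc l -> s kF = Leaf ->
  runs (While (EVar kS) loop_body) s ((body_time + 2) * (sumn (map w l)).+1 + 2)
    (fun s' => s' kF <> Leaf <-> goodS l).
Proof using cn_kS p_kS kS_gt1 cn_runs branch_ok leaf_ok.
have [m] := ubnP (sumn (map w l)); elim: m l s => // m IH [|x l] s lm okl sS sF.
  exists 2, s; split; first by apply: (ExecWhileFalse (e := EVar _)); rewrite /= sS.
    by rewrite leq_addl.
  by split=> // /(_ sF).
have [okx {}okl] := okl.
have [t1 [s1 [x1 h1 H]]] := runs_body okx okl sS sF.
have cond : eval (EVar kS) s <> Leaf by rewrite /= sS.
case: H => [[l' [sS' sF' okl' lt gd]]|[sS' sF' gd]].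
  have [|t2 [s2 [x2 h2 H2]]] := IH l' s1 _ okl' sS' sF'; first by apply: leq_trans lt _.
  exists (1 + t1 + t2).+1, s2; split; first exact: (ExecWhileTrue (e := EVar _) cond x1 x2).
    have : (body_time + 2) * (sumn (map w l')).+1 <= (body_time + 2) * sumn (map w (x :: l)).
      by rewrite leq_mul2l lt orbT.
    move: h1 h2; rewrite [_ * (sumn (map w (x :: l))).+1]mulnS.
    by move: ((body_time + 2) * (sumn (map w l')).+1) ((body_time + 2) * sumn (map w (x :: l)))
      (body_time) => a b c; lia.
  by rewrite H2 gd.
exists (1 + t1 + 2).+1, s1; split => //.
  apply: (ExecWhileTrue (e := EVar _) cond x1); apply: (ExecWhileFalse (e := EVar _)).
  by rewrite /= sS'.
by rewrite mulnS; move: (_ * _) => a; lia.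
Qed.

Lemma runs_search cs Ts s l : okS l ->
  runs cs s Ts (fun s' => s' 0 = enc l) ->
  runs (Seq cs (Seq (Assign kS (EVar 0)) (Seq (Assign kF ENil)
     (Seq (While (EVar kS) loop_body) (Assign 0 (EVar kF)))))) s
    (Ts + (body_time + 2) * (sumn (map w l)).+1 + 12) (fun s' => s' 0 <> Leaf <-> goodS l).
Proof using cn_kS p_kS kS_gt1 cn_runs branch_ok leaf_ok.
move=> okl H.
apply: (@runs_weak _ _ (Ts + (2 + (2 + (((body_time + 2) * (sumn (map w l)).+1 + 2) + 2).+1).+1).+1).+1) (fun _ h => h); last by lia.
apply: (runs_seq H) => s1 s10.
apply: (runs_seq (runs_assign (P := fun s' => s' kS = enc l) _)); first by rewrite /upd /= eqxx.
move=> s2 s2S; apply: (runs_seq (runs_assign (e := ENil) (P := fun s' => s' kS = enc l /\ s' kF = Leaf) _)).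
  by rewrite /upd eqxx ltn_eqF.
move=> s3 [s3S s3F]; apply: (runs_seq (runs_loop okl s3S s3F)) => s4 H4.
by apply: (runs_assign (e := EVar _)); rewrite /upd /=.
Qed.

End MainLoop.

(** * Growth of the search tree *)

Lemma horner_nat_homo (q : {poly nat}) a b : a <= b -> q.[a]%R <= q.[b]%R.
Proof.
move=> ab; elim/poly_ind: q => [|q c IH]; first by rewrite !horner0.
by rewrite !hornerMXaddC; apply: (@leq_add (q.[a]%R * a)%N c (q.[b]%R * b)%N c) => //; apply: leq_mul.
Qed.

Lemma pb_horner {A : Type} {eA : Enc A} (q : {poly nat}) (f : A -> nat) :
  pb f -> pb (fun a => q.[f a]%R).
Proof.
move=> F; elim/poly_ind: q => [|q c IH].
  by apply: (pb_le (pb_const 0)) => a; rewrite horner0.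
apply: (pb_le (pbD (pbM IH F) (pb_const c))) => a.
by rewrite hornerMXaddC; apply: (leqnn (q.[f a]%R * f a + c)%N).
Qed.

Section Growth.
Local Open Scope ring_scope.
Variable RR : realType.

Lemma bernoulli_nat (x : RR) n : 0 <= x -> 1 + n%:R * x <= (1 + x) ^+ n.
Proof.
move=> x0; elim: n => [|n IH]; first by rewrite mul0r addr0 expr0.
rewrite exprS; apply: le_trans (_ : (1 + x) * (1 + n%:R * x) <= _); last first.
  by rewrite ler_wpM2l // addr_ge0.
have : (0 : RR) <= n%:R by [].
by rewrite -natr1; move: (n%:R) => y y0; nra.
Qed.

(* With [x = 1 + 1/k], the numbers [w m = 2 x^m - 1] satisfy
   [w (m - 1) + w (m - b) + 1 <= w m] as soon as [x^(b-1) (x - 1) >= 1]. *)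
Definition tree_weight (k m : nat) : nat :=
  Num.truncn (2 * (1 + k%:R^-1) ^+ m - 1 : RR).

Lemma expr_1D_ge1 (k m : nat) : (1 : RR) <= (1 + k%:R^-1) ^+ m.
Proof. by apply: exprn_ege1; rewrite lerDl invr_ge0. Qed.

Lemma tree_weight_gt0 k m : (0 < tree_weight k m)%N.
Proof. by rewrite truncn_gt0 lerBrDr -mulr2n -mulr_natr mul1r ler_peMr // expr_1D_ge1. Qed.

Lemma tree_weight_le k m : (tree_weight k m)%:R <= 2 * (1 + k%:R^-1) ^+ m - 1 :> RR.
Proof.
rewrite truncn_le; have := expr_1D_ge1 k m; move: (_ ^+ m) => y y1.
by rewrite subr_ge0 (le_trans y1) // ler_peMl ?(le_trans ler01 y1) // ler1n.
Qed.

Lemma tree_weight_branch j b m a c : (2 ^ j * j < b)%N -> (a < m)%N -> (c + b <= m)%N ->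
  (tree_weight (2 ^ j) a + tree_weight (2 ^ j) c < tree_weight (2 ^ j) m)%N.
Proof.
set k := (2 ^ j)%N => jb am cbm; rewrite /tree_weight truncn_gt_nat -/(tree_weight k a) -/(tree_weight k c).
rewrite -natr1 natrD; apply: le_trans (_ : (2 * (1 + k%:R^-1) ^+ a - 1) + (2 * (1 + k%:R^-1) ^+ c - 1) + 1 <= _).
  by rewrite lerD2r lerD // tree_weight_le.
set x : RR := 1 + k%:R^-1.
have k0 : (0 : RR) < k%:R by rewrite ltr0n expn_gt0.
have x1 : 1 <= x by rewrite lerDl invr_ge0 ltW.
suff H : x ^+ a + x ^+ c <= x ^+ m.
  rewrite addrACA -mulrDr -[_ + 1]addrA subrK.
  by rewrite lerD2r ler_wpM2l.
(* By the Bernoulli inequality [x ^ k >= 2], so [x ^ (k * j) >= 2 ^ j = k], the inverse of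
   [x - 1]. *)
have xb : k%:R <= x ^+ b.-1.
  apply: le_trans (_ : x ^+ (k * j) <= _); last by rewrite ler_weXn2l // -ltnS prednK // (leq_ltn_trans _ jb).
  rewrite exprM /k natrX; apply: lerXn2r; rewrite ?nnegrE ?exprn_ge0 ?(le_trans ler01 x1) //.
  apply: le_trans (bernoulli_nat k _); last by rewrite invr_ge0 ltW.
  by rewrite mulfV ?gt_eqF.
apply: le_trans (_ : x ^+ m.-1 + x ^+ (m - b) <= _).
  rewrite lerD // ler_weXn2l //; first by rewrite -ltnS prednK // (leq_ltn_trans _ am).
  by rewrite leq_subRL ?(leq_trans (leq_addl _ _) cbm) // addnC.
have bm : (b <= m)%N := leq_trans (leq_addl _ _) cbm.
have b0 : (0 < b)%N := leq_ltn_trans (leq0n _) jb.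
have -> : m.-1 = (m - b + b.-1)%N by lia.
have -> : m = (m - b + b)%N by rewrite subnK.
rewrite addnK !exprD -[X in _ + X]mulr1 -mulrDr ler_wpM2l ?exprn_ge0 ?(le_trans ler01 x1) //.
rewrite -{2}(prednK b0) exprS {2}/x mulrDl mul1r lerD2l.
by rewrite mulrC ler_pdivlMr // mul1r.
Qed.

Lemma tree_weight_expR k m : (tree_weight k m)%:R <= 2 * expR (m%:R / k%:R) - 1 :> RR.
Proof.
apply: le_trans (tree_weight_le k m) _; rewrite lerD2r ler_wpM2l // mulrC.
rewrite expRM_natr; apply: lerXn2r; rewrite ?nnegrE ?expR_ge0 ?expR_ge1Dx //.
Qed.

End Growth.

Section Littleo.
Local Open Scope classical_set_scope.
Local Open Scope ring_scope.

(** The constant absorbs the finitely many arguments below the threshold, as the sum of the absolute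
    values there. *)
Lemma littleo_affine (RR : realType) (g : nat -> RR) (eps : RR) :
  g =o_\oo (fun N : nat => N%:R : RR) -> 0 < eps ->
  exists G, forall N, g N <= eps * N%:R + G.
Proof.
move=> /eqoP H e0; have [M _ HM] := H eps e0.
exists (\sum_(i < M) `|g i|) => N; have [MN|NM] := leqP M N.
  have := HM N MN; rewrite /= normr_nat => h; apply: le_trans (ler_norm _) _.
  by apply: le_trans h _; rewrite lerDl sumr_ge0.
apply: le_trans (ler_norm _) _; rewrite (bigD1 (Ordinal NM)) //= addrCA lerDl.
by rewrite addr_ge0 ?sumr_ge0 // mulr_ge0 // ltW.
Qed.

End Littleo.

Lemma state_size_homo n n' m m' : n <= n' -> m <= m' -> state_size n m <= state_size n' m'.
Proof.
move=> nn mm; rewrite /state_size leq_add // !ltnS leq_add //.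
- by rewrite !leq_mul // leq_add // leq_mul.
- by rewrite !leq_mul // leq_add.
- by apply: leq_mul; [rewrite leq_exp2r // leq_mul | rewrite leq_add // leq_mul].
Qed.

Lemma sz_nat_cnf n (phi : cnf n) : is_3cnf phi ->
  sz (n, nat_cnf phi) <= (n + size phi * (3 * (n + 2)).+1).+1.
Proof.
move=> phi3; rewrite (sz_pair (_, _)) sz_nat /= ltnS leq_add2l.
apply: leq_trans (@sz_leq _ _ _ (3 * (n + 2)) _) _; last by rewrite size_map.
move=> _ /mapP[cl clp ->]; apply: leq_trans (@sz_leq _ _ _ n.+1 _) _; last first.
  by rewrite size_map addn2 leq_mul2r phi3 ?orbT.
move=> _ /mapP[l _ ->]; rewrite sz_pair sz_nat /=.
by have := ltn_ord l.1; have := sz_bool l.2; move: (sz l.2) (l.1 : nat) => a b; lia.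
Qed.

(** * The complete search with a given solver *)

Section Search.
Variables (RR : realType) (p : cmd) (t1 t2 j : nat).
Hypotheses (t1_gt0 : 0 < t1) (t2_gt0 : 0 < t2) (hj : 2 ^ j * j < minn (4 * t1 ^ 2) t2).

(** [S] pays for one search step and [Tp] for one call of the solver, which has to be correct on
    leaf instances only. The weight of the root potential bounds the number of rounds. *)
Lemma sparsify_and_solve : exists (prog : cmd) (S : nat -> nat), pb S /\
  forall n (phi : cnf n) Tp, is_3cnf phi ->
  (forall T s, wfT n T -> wf t1 n s -> branches t1 t2 n T s = [::] ->
     exists t st, [/\ exec p (init_store (enc_unweighted (leaf_instance RR t1 t2 ((n, T), s)))) t st,
        t <= Tp & st 0 <> Leaf <-> stars_nws (leaf_instance RR t1 t2 ((n, T), s))]) ->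
  runs prog (init_store (enc_cnf phi))
    ((S (n + size phi) + Tp) * (tree_weight RR (2 ^ j) (16 * t1 * n) + 2))
    (fun s' => s' 0 <> Leaf <-> satisfiable phi).
Proof using t1_gt0 t2_gt0 hj.
have [_ [cn [Tn [[kn Hkn] cnH]]]] := PT_next t1 t2 (t1 + t2).+1.
have [_ [cs [Ts [[ks Hks] csH]]]] := PT_start.
pose kS := maxn 2 (maxn (cvars cn) (cvars p)).
pose Sn y := (state_size y y + 2) ^ kn.
pose Ss y := ((y + y * (3 * (y + 2)).+1).+1 + 2) ^ ks.
exists (Seq cs (Seq (Assign kS (EVar 0)) (Seq (Assign kS.+1 ENil)
     (Seq (While (EVar kS) (loop_body cn p kS)) (Assign 0 (EVar kS.+1)))))).
exists (fun y => Ss y + Sn y + 4 * kS + 64); split.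
  assert (py : pb (fun y : nat => y)) by (apply: (pb_le pb_sz) => y; rewrite sz_nat //).
  rewrite /Ss /Sn /state_size.
  by do ?[apply: pbD | apply: pbX | apply: pbS | apply: pbM | exact: py | exact: pb_const].
move=> n phi Tp phi3 leafH; set y := n + size phi; set tw := tree_weight _ _ _.
pose T := triples_of (nat_cnf phi).
pose ok (x : (nat * seq triple) * state) := [/\ x.1 = (n, T), wfT n T & wf t1 n x.2].
pose good (x : (nat * seq triple) * state) := exists al, models x.1.2 x.2 al.
pose w (x : (nat * seq triple) * state) := tree_weight RR (2 ^ j) (mu t1 n x.2).
have cn_runs x s : ok x -> s 0 = enc x ->
    runs cn s (Sn y) (fun s' => s' 0 = enc (next t1 t2 (t1 + t2).+1 x)).
  move=> [x1 WT W] s0; apply: runs_weak (cnH _ _ s0) _ (fun _ h => h).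
  apply: leq_trans (Hkn x) _; rewrite /Sn; case: (kn) => // k; rewrite leq_exp2r // leq_add2r.
  rewrite [x]surjective_pairing x1; apply: leq_trans (sz_state WT W) _.
  by rewrite size_map state_size_homo ?leq_addr ?leq_addl.
have branch_ok x : ok x -> (next t1 t2 (t1 + t2).+1 x).1 ->
  [/\ ok (next t1 t2 (t1 + t2).+1 x).2.1.1, ok (next t1 t2 (t1 + t2).+1 x).2.1.2,
     w (next t1 t2 (t1 + t2).+1 x).2.1.1 + w (next t1 t2 (t1 + t2).+1 x).2.1.2 < w x
    & good x <-> good (next t1 t2 (t1 + t2).+1 x).2.1.1 \/ good (next t1 t2 (t1 + t2).+1 x).2.1.2].
  case: x => nT s [/= -> WT W] /=; rewrite /nilp size_eq0 => br.
  have [W1 W2 m1 m2] := branches_wf t1_gt0 t2_gt0 (s, s) WT W br.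
  split=> //; first exact: tree_weight_branch hj m1 m2.
  rewrite /good /=; split=> [[al]|].
    by rewrite (branches_models (s, s) _ br) => /orP[] H; [left | right]; exists al.
  by case=> -[al H]; exists al; rewrite (branches_models (s, s) _ br) H ?orbT.
have leaf_ok x : ok x -> ~~ (next t1 t2 (t1 + t2).+1 x).1 -> 0 < w x /\
   exists t s, [/\ exec p (init_store (enc (next t1 t2 (t1 + t2).+1 x).2.2)) t s, t <= Tp & s 0 <> Leaf <-> good x].
  case: x => nT s [/= -> WT W]; rewrite /= negbK /nilp size_eq0 => /eqP L.
  split; first exact: tree_weight_gt0.
  have [t [st [ex tT ans]]] := leafH _ _ WT W L; exists t, st; split=> //.
    by rewrite enc_leaf in ex.
  by rewrite ans leaf_instance_correct.
have kS1 : 1 < kS by rewrite leq_maxl.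
have kSn : cvars cn <= kS by rewrite !leq_max leqnn orbT.
have kSp : cvars p <= kS by rewrite !leq_max leqnn !orbT.
have okl : okS ok (start (n, nat_cnf phi)).
  rewrite /start /=; case: ifP => //= /negbT nn; split=> //; split=> //; first exact: wfT_start.
have cs_runs : runs cs (init_store (enc_cnf phi)) (Ss y) (fun s' => s' 0 = enc (start (n, nat_cnf phi))).
  apply: runs_weak (csH _ _ _) _ (fun _ h => h); first by rewrite /init_store /upd /= enc_nat_cnf.
  apply: leq_trans (Hks _) _; rewrite /Ss; case: (ks) => // k; rewrite leq_exp2r // leq_add2r.
  apply: leq_trans (sz_nat_cnf phi3) _; rewrite ltnS leq_add ?leq_addr // leq_mul ?leq_addl //.
  by rewrite ltnS leq_mul2l leq_add2r leq_addr orbT.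
apply: runs_weak (runs_search kSn kSp kS1 cn_runs branch_ok leaf_ok okl cs_runs) _ _.
  (* The root has neither units nor pairs, so its potential is [8 * t1 * (n * 2)]. *)
  have : sumn [seq w x | x <- start (n, nat_cnf phi)] <= tw.
    rewrite /start /=; case: ifP => //= _; rewrite addn0 /w /mu /= subn0 /blive /= subn0.
    by rewrite /tw mulnA mulnC !mulnA mulnC; apply: eq_leq; congr tree_weight; lia.
  rewrite /body_time; move: (sumn _) tw (Ss y) (Sn y) => a b c d; nia.
move=> s' ->; rewrite /start /=; case: ifP => [nn|/negbT nn] /=.
  by split=> // /(nil_unsat nn).
rewrite -(models_start phi3 nn); split; first by case.
by left.
Qed.

End Search.

(** * Choice of the thresholds *)

(** This is [j * 2 ^ j < t2] for [j = 4 * i] and [t2 = 2 ^ (6 * i)], with [2 ^ j] cancelled. *)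
Lemma ltn_4i_exp i : 2 <= i -> 4 * i < 2 ^ (2 * i).
Proof.
elim: i => // -[//|[//|i]] IH _; move: (IH isT).
by rewrite [2 * i.+3]mulnS expnD; move: (2 ^ _) => x; lia.
Qed.

Section Thresholds.
Local Open Scope ring_scope.
Variable RR : realType.

(** [16 / 2 ^ i] will be the growth exponent of the search tree per variable; it must fit into half
    of the available exponent. *)
Lemma threshold_exists (delta : RR) : 0 < delta ->
  exists i : nat, (2 <= i)%N /\ 16 / 2 ^+ i <= delta / 2 * ln 2.
Proof.
move=> d0; have l0 : (0 : RR) < ln 2 by rewrite ln_gt0 // ltr1n.
pose c : RR := 32 / (delta * ln 2).
have c0 : 0 <= c by rewrite divr_ge0 // mulr_ge0 // ltW.
exists (maxn 2 (Num.truncn c).+1); split; first exact: leq_maxl.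
set i := maxn _ _.
have ci : c <= 2 ^+ i.
  have /andP[_ /ltW h] := truncn_itv c0; apply: le_trans h _.
  rewrite -natrX ler_nat; apply: leq_trans (ltnW (ltn_expl i (isT : (1 < 2)%N))).
  exact: leq_maxr.
rewrite ler_pdivrMr ?exprn_gt0 //.
move: ci; rewrite /c ler_pdivrMr ?mulr_gt0 //; move: (2 ^+ i) (ln 2) => x l; nra.
Qed.

Lemma powR2E (x : RR) : 2 `^ x = expR (x * ln 2).
Proof. by rewrite mulrC expRM lnK // posrE. Qed.

End Thresholds.

(** * The lower bound *)

Local Open Scope classical_set_scope.
Local Open Scope ring_scope.

Theorem theorem6 (R : realType) :
  ETH R ->
  ~ exists (p : cmd) (g : nat -> R) (q : {poly nat}),
      g =o_\oo (fun N : nat => N%:R : R) /\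
      forall I : instance R,
        unweighted I -> is_clique I ->
        (forall C, C \in communities I -> (#|C| <= 4)%N) ->
        answers_within p (enc_unweighted I) (stars_nws I)
          (2 `^ g (nverts I ^ 2 + ncomms I)%N
           * (q.[(nverts I + ncomms I)%N])%:R).
Proof.
move=> [delta d0 nosolve] [p [g [q0 [gO Hp]]]]; apply: nosolve.
have [i [i2 hi]] := threshold_exists d0.
(* [2 ^ j] lies between [t1] and [t1 ^ 2]: well above [t1], so that the potential [16 * t1 * n]
   divided by it is small, and so far below the drop of about [t1 ^ 2] that the factor [j] still
   fits. *)
pose t1 := (2 ^ (3 * i))%N; pose t2 := (2 ^ (6 * i))%N; pose j := (4 * i)%N.
have t1_gt0 : (0 < t1)%N by rewrite expn_gt0.
have t2_gt0 : (0 < t2)%N by rewrite expn_gt0.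
have hj : (2 ^ j * j < minn (4 * t1 ^ 2) t2)%N.
  have h : (2 ^ j * j < t2)%N.
    have -> : t2 = (2 ^ j * 2 ^ (2 * i))%N by rewrite -expnD -mulnDl.
    by rewrite ltn_pmul2l ?expn_gt0 // ltn_4i_exp.
  rewrite leq_min h andbT (leq_trans h) //.
  by rewrite /t1 -expnM mulnAC leq_pmull.
pose C := leaf_const t1 t2.
have C0 : (0 < C%:R :> R) by rewrite ltr0n /C /leaf_const addn_gt0 orbT.
(* Leaf instances have measure at most [C * n.+1], so the solver's exponent is at most
   [delta / 2 * n] plus the constant [delta / 2 + G], which [c0] absorbs. *)
have [G HG] : exists G, forall N, g N <= delta / 2 / C%:R * N%:R + G.
  by apply: littleo_affine gO _; rewrite !divr_gt0.
have [c0 Hc0] : exists c0 : nat, 2 `^ (delta / 2 + G) <= c0%:R.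
  exists (Num.truncn (2 `^ (delta / 2 + G))).+1.
  by have /andP[_ /ltW] := truncn_itv (powR_ge0 2 (delta / 2 + G)).
have [prog [S [pS H]]] := sparsify_and_solve R p t1_gt0 t2_gt0 hj.
have [K0 HK0] : pb (fun y : nat => ((S y + c0 * q0.[(C * y.+1)%N]) * 3)%N).
  apply: pbM (pb_const _); apply: pbD pS _; apply: pbM (pb_const _) _.
  apply: pb_horner; apply: pbM (pb_const _) _; apply: pbS.
  by apply: (pb_le pb_sz) => y; rewrite sz_nat.
exists prog, (('X + 2%:P) ^+ K0) => n phi phi3.
pose E : R := 2 `^ (delta / 2 * n%:R).
have E1 : 1 <= E.
  by rewrite /E powR2E -[X in X <= _]expR0 ler_expR !mulr_ge0 // ?ltW // ln_gt0 // ltr1n.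
have E0 : 0 <= E := le_trans ler01 E1.
pose Q : nat := q0.[(C * n.+1)%N].
(* The number of steps is a natural number, so the real bound may be truncated. *)
pose Tp := Num.truncn (E * c0%:R * Q%:R).
have TpE : Tp%:R <= E * c0%:R * Q%:R by rewrite truncn_le !mulr_ge0.
have [T s WT W L|t [st [ex tT ans]]] := H n phi Tp phi3.
  have [] := Hp (leaf_instance R t1 t2 ((n, T), s)).
  - exact: gadget_unweighted.
  - exact: gadget_clique.
  - exact: gadget_size4.
  set I := leaf_instance _ _ _ _; move=> t [st [ex tT ans]]; exists t, st; split=> //.
  have sI : (nverts I ^ 2 + ncomms I <= C * n.+1)%N := leaf_instance_size R WT W L.
  rewrite truncn_ge_nat ?mulr_ge0 //; apply: le_trans tT _; apply: ler_pM => //.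
  - apply: le_trans (_ : 2 `^ (delta / 2 * n%:R + (delta / 2 + G)) <= _).
      apply: ler_powR; first by rewrite ler1n.
      apply: le_trans (HG _) _; rewrite addrA lerD2r.
      apply: le_trans (_ : delta / 2 / C%:R * (C * n.+1)%:R <= _).
        by rewrite ler_wpM2l ?ler_nat // ltW // !divr_gt0.
      by rewrite natrM mulrA divfK ?gt_eqF // -(natr1 n) mulrDr mulr1.
    by rewrite powRD ?pnatr_eq0 ?implybT // ler_wpM2l.
  - rewrite ler_nat; apply: horner_nat_homo; apply: leq_trans sI.
    by rewrite leq_add2r; case: (nverts I) => // k; rewrite leq_pmulr.
exists t, st; split=> //.
set y := (n + size phi)%N in tT *.
(* The weight is at most [2 * e - 1] with [e <= E], and adding 2 leaves at most [3 * E] because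
   [E >= 1]. *)
have tw : (tree_weight R (2 ^ j) (16 * t1 * n) + 2)%:R <= 3 * E.
  rewrite natrD; apply: le_trans (lerD (tree_weight_expR _ _ _) (lexx _)) _.
  have : expR ((16 * t1 * n)%:R / (2 ^ j)%:R) <= E.
    rewrite /E powR2E ler_expR.
    have -> : (16 * t1 * n)%:R / (2 ^ j)%:R = 16 / 2 ^+ i * n%:R :> R.
      have -> : (2 ^ j = t1 * 2 ^ i)%N by rewrite /t1 /j -expnD; congr (2 ^ _)%N; lia.
      rewrite !natrM natrX; field.
      by rewrite expf_neq0 ?pnatr_eq0 // -lt0n.
    by rewrite [X in _ <= X]mulrAC ler_wpM2r.
  by move: (expR _) => e; lra.
(* One factor [E] pays for a call of the solver, the other for the search tree; together they use up
   the exponent [delta * n]. *)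
apply: le_trans (_ : (E * (S y + c0 * Q)%:R) * (3 * E) <= _).
  apply: le_trans (_ : ((S y + Tp) * (tree_weight R (2 ^ j) (16 * t1 * n) + 2))%:R <= _).
    by rewrite ler_nat.
  rewrite natrM; apply: ler_pM => //; rewrite !natrD natrM mulrDr.
  by apply: lerD; [rewrite ler_peMl | rewrite mulrA].
have -> : 2 `^ (delta * n%:R) = E * E.
  by rewrite /E -powRD ?pnatr_eq0 ?implybT // -mulrDl -splitr.
have -> : E * (S y + c0 * Q)%:R * (3 * E) = E * E * ((S y + c0 * Q) * 3)%:R.
  by rewrite natrM; ring.
rewrite ler_wpM2l ?mulr_ge0 // ler_nat horner_exp hornerD hornerX hornerC.
have HK := HK0 y; rewrite sz_nat in HK; apply: leq_trans (leq_trans _ HK) _.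
  rewrite leq_mul2r orFb leq_add2l leq_mul2l; apply/orP; right.
  by apply: horner_nat_homo; rewrite leq_mul2l ltnS leq_addr orbT.
by elim: (K0) => // k IH; rewrite exprS expnS; apply: leq_mul.
Qed.
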